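(* Let $\kappa$ be an infinite cardinal less than the continuum, and assume $BP(\kappa)$. Let $X$ be a connected, locally path connected $\kappa$-Polish space. Then the first singular homology group $H_1(X)$ has cardinality at most $\kappa$ or cardinality equal to the continuum.
   Context: A topological space is $\kappa$-separable if it has a dense subset of cardinality at most $\kappa$, and $\kappa$-Polish if it is completely metrizable and $\kappa$-separable. If $Y$ is a Polish space (separable, completely metrizable), a set $A\subseteq Y$ is $\kappa$-Suslin if there is a closed set $D\subseteq Y\times\kappa^{\mathbb{N}}$ (with $\kappa$ discrete and $\kappa^{\mathbb{N}}$ the product topology) whose projection to $Y$ is $A$. A set $A\subseteq Y$ has the property of Baire if there is an open $O\subseteq Y$ with $(A\cup O)\setminus(A\cap O)$ meager. $BP(\kappa)$ is the statement that every $\kappa$-Suslin subset of every Polish space has the property of Baire. *)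

(* Defs.v *)
From Stdlib Require Import Reals ZArith List Classical ClassicalEpsilon.
Open Scope R_scope.

Definition inj {A B : Type} (f : A -> B) : Prop := forall x y, f x = f y -> x = y.

Definition cdec (P : Prop) : bool :=
  if excluded_middle_informative P then true else false.

Section Metric.
Context {X : Type} (d : X -> X -> R).

Definition is_metric : Prop :=
  (forall x y, 0 <= d x y) /\ (forall x y, d x y = 0 <-> x = y) /\
  (forall x y, d x y = d y x) /\ (forall x y z, d x z <= d x y + d y z).

Definition cauchy (u : nat -> X) : Prop :=
  forall eps, 0 < eps -> exists N, forall m n, (N <= m)%nat -> (N <= n)%nat ->
    d (u m) (u n) < eps.

Definition converges (u : nat -> X) : Prop :=
  exists l, forall eps, 0 < eps -> exists N, forall n, (N <= n)%nat -> d (u n) l < eps.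

Definition complete : Prop := forall u, cauchy u -> converges u.

Definition mopen (U : X -> Prop) : Prop :=
  forall x, U x -> exists eps, 0 < eps /\ forall y, d x y < eps -> U y.

Definition dense (D : X -> Prop) : Prop :=
  forall x eps, 0 < eps -> exists y, D y /\ d x y < eps.

(* kappa-separable, kappa given as (the cardinality of) a type K *)
Definition separable (K : Type) : Prop :=
  exists D : X -> Prop, dense D /\ exists f : {x : X | D x} -> K, inj f.

Definition closure (N : X -> Prop) : X -> Prop :=
  fun x => forall eps, 0 < eps -> exists y, N y /\ d x y < eps.

Definition nowhere_dense (N : X -> Prop) : Prop :=
  forall U, mopen U -> (forall x, U x -> closure N x) -> forall x, ~ U x.

Definition meager (M : X -> Prop) : Prop :=
  exists N : nat -> X -> Prop, (forall n, nowhere_dense (N n)) /\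
    forall x, M x -> exists n, N n x.

Definition has_baire_property (A : X -> Prop) : Prop :=
  exists O, mopen O /\ meager (fun x => (A x \/ O x) /\ ~ (A x /\ O x)).

Definition connected : Prop :=
  forall U V, mopen U -> mopen V -> (forall x, U x \/ V x) ->
    (forall x, ~ (U x /\ V x)) -> (forall x, ~ U x) \/ (forall x, ~ V x).

(* singular simplices: Delta^1 = [0,1]; Delta^2 = {(a,b) | a,b >= 0, a+b <= 1},
   the point (a,b) having barycentric coordinates (1-a-b, a, b), so the vertices
   are e0 = (0,0), e1 = (1,0), e2 = (0,1). A simplex is a function on R
   (resp. R*R), only its restriction to the standard simplex matters. *)
Definition in_D1 (t : R) : Prop := 0 <= t <= 1.
Definition in_D2 (a b : R) : Prop := 0 <= a /\ 0 <= b /\ a + b <= 1.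

Definition cont1 (g : R -> X) : Prop :=
  forall t, in_D1 t -> forall eps, 0 < eps -> exists delta, 0 < delta /\
    forall t', in_D1 t' -> Rabs (t - t') < delta -> d (g t) (g t') < eps.

Definition cont2 (s : R -> R -> X) : Prop :=
  forall a b, in_D2 a b -> forall eps, 0 < eps -> exists delta, 0 < delta /\
    forall a' b', in_D2 a' b' -> Rabs (a - a') + Rabs (b - b') < delta ->
      d (s a b) (s a' b') < eps.

Definition path_connected_set (V : X -> Prop) : Prop :=
  forall y z, V y -> V z -> exists g, cont1 g /\ g 0 = y /\ g 1 = z /\
    forall t, in_D1 t -> V (g t).

Definition loc_path_connected : Prop :=
  forall x U, mopen U -> U x -> exists V, mopen V /\ V x /\
    (forall y, V y -> U y) /\ path_connected_set V.

End Metric.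

(* open sets of Y x K^N, K discrete, product topology *)
Definition prod_open {Y K : Type} (d : Y -> Y -> R) (W : Y -> (nat -> K) -> Prop) : Prop :=
  forall y a, W y a -> exists eps n, 0 < eps /\
    forall y' a', d y y' < eps -> (forall i, (i < n)%nat -> a' i = a i) -> W y' a'.

Definition prod_closed {Y K : Type} (d : Y -> Y -> R) (D : Y -> (nat -> K) -> Prop) : Prop :=
  prod_open d (fun y a => ~ D y a).

Definition suslin {Y : Type} (K : Type) (d : Y -> Y -> R) (A : Y -> Prop) : Prop :=
  exists D : Y -> (nat -> K) -> Prop, prod_closed d D /\
    forall y, A y <-> exists a, D y a.

Definition BP (K : Type) : Prop :=
  forall (Y : Type) (d : Y -> Y -> R), is_metric d -> complete d -> separable d nat ->
    forall A, suslin K d A -> has_baire_property d A.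

Section Homology.
Context {X : Type}.

Definition chain1 := list (Z * (R -> X)).
Definition chain2 := list (Z * (R -> R -> X)).

Definition same1 (f g : R -> X) : Prop := forall t, in_D1 t -> f t = g t.

Definition coeff1 (c : chain1) (s : R -> X) : Z :=
  fold_right (fun p acc => ((if cdec (same1 (snd p) s) then fst p else 0) + acc)%Z) 0%Z c.

Definition bd1coeff (c : chain1) (x : X) : Z :=
  fold_right (fun p acc =>
    (fst p * ((if cdec (snd p 1%R = x) then 1 else 0) - (if cdec (snd p 0%R = x) then 1 else 0))
     + acc)%Z) 0%Z c.

(* faces d_i s = s restricted to the face opposite e_i *)
Definition face0 (s : R -> R -> X) : R -> X := fun t => s (1 - t) t.  (* [e1,e2] *)
Definition face1 (s : R -> R -> X) : R -> X := fun t => s 0 t.        (* [e0,e2] *)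
Definition face2 (s : R -> R -> X) : R -> X := fun t => s t 0.        (* [e0,e1] *)

Definition bd2 (m : chain2) : chain1 :=
  flat_map (fun p => (fst p, face0 (snd p)) :: (Z.opp (fst p), face1 (snd p))
                      :: (fst p, face2 (snd p)) :: nil) m.

End Homology.

Section H1.
Context {X : Type} (d : X -> X -> R).

Definition singular1 (c : @chain1 X) : Prop := Forall (fun p => cont1 d (snd p)) c.
Definition singular2 (m : @chain2 X) : Prop := Forall (fun p => cont2 d (snd p)) m.

Definition cycle1 (c : chain1) : Prop := singular1 c /\ forall x, bd1coeff c x = 0%Z.

Definition homologous (c c' : chain1) : Prop :=
  exists m, singular2 m /\ forall s, (coeff1 c s - coeff1 c' s)%Z = coeff1 (bd2 m) s.

Definition H1_card_le (K : Type) : Prop :=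
  exists f : chain1 -> K, forall c c', cycle1 c -> cycle1 c' -> f c = f c' -> homologous c c'.

Definition H1_card_continuum : Prop :=
  exists g : (nat -> bool) -> chain1,
    (forall b, cycle1 (g b)) /\ (forall b b', homologous (g b) (g b') -> b = b') /\
    (forall c, cycle1 c -> exists b, homologous c (g b)).

End H1.

(* Main.v *)
Require Import Defs.
From Stdlib Require Import Reals.
From Stdlib Require Import ZArith List Classical ClassicalEpsilon Cantor Wf_nat Lia Lra.
From Stdlib Require Import ProofIrrelevance FunctionalExtensionality PropExtensionality.
From mathcomp Require classical_sets.
From Coquelicot Require Compactness Rcomplements.
(* Reals also declares a [cont1]. *)
Import Defs.

(** Say that a ball is null if every loop in it bounds in X.

If every point lies in a null ball whose centre is in the dense set D (and
whose radius is a power of 1/2), a cycle can be cut into pieces each of which,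
after moving its endpoints into D along short paths, lies in one such ball.
The corrections cancel because the boundary is zero, and the class of a piece
depends only on the ball and on the two endpoints; so a class is coded by a
finite list over K, and there are at most kappa lists.

Otherwise there are arbitrarily small essential loops [l n] at some point. For
b in 2^N let L b be the infinite concatenation of the [l n] with [b n = true].
If b and b' differ in exactly one place n then L b - L b' is homologous to
[l n] or its negative, hence is essential. The relation "L b and L b' are
homologous" is kappa-Suslin on 2^N x 2^N: a bounding 2-chain is coded by
integers and by the values of its simplices at rational points, and the
condition on the code is closed. By BP(kappa) the relation has the property of
Baire, so it is meager, and there are continuum many pairwise inequivalent b.
The upper bound holds because X has at most continuum many paths.

In both cases the explicit bounding 2-chains consist of triangles [g o phi] with
[g] a path and [phi] affine into [0,1], so no homotopies are needed. *)

(** * Cardinal arithmetic *)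

(** [BP K] speaks of Polish spaces, whereas [X] is only [K]-separable. So the relation is placed on
    the Cantor square, and [X] enters only through the Suslin witness, where its points are coded by
    sequences over [K]. The witness set must be closed, and two conditions in the definition of
    homology are not: continuity of the unknown triangles, and equality of chains, which hinges on
    which of finitely many paths coincide. The code therefore also carries moduli of continuity and
    a colouring of the terms as integers; this leaves non-strict inequalities, equalities of points
    and finite integer sums. In the wedge, [l n] keeps its own interval of [0,1] whatever the other
    bits are: changing one bit changes the path on one interval only, and the value at a fixed time
    depends on a single bit. *)

Lemma choice {A B : Type} (P : A -> B -> Prop) :
  (forall x, exists y, P x y) -> exists f : A -> B, forall x, P x (f x).
Proof.
  intros H. exists (fun x => proj1_sig (constructive_indefinite_description _ (H x))).
  intros x. exact (proj2_sig (constructive_indefinite_description _ (H x))).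
Qed.

Lemma choice_on {A B : Type} (b0 : B) (D : A -> Prop) (P : A -> B -> Prop) :
  (forall x, D x -> exists y, P x y) -> exists f : A -> B, forall x, D x -> P x (f x).
Proof.
  intros H. apply (choice (fun x y => D x -> P x y)). intros x.
  destruct (classic (D x)) as [h|h].
  - destruct (H x h) as [y hy]. exists y. auto.
  - exists b0. tauto.
Qed.

Lemma left_inverse {A B : Type} (a0 : A) (f : A -> B) :
  inj f -> exists g : B -> A, forall x, g (f x) = x.
Proof.
  intros Hf.
  destruct (choice_on a0 (fun y => exists x, f x = y) (fun y x => f x = y)) as [g hg];
    [auto|].
  exists g. intros x. apply Hf, hg. eauto.
Qed.

(** The chain [F] may be empty, so the hypothesis includes [P] of the empty set; each use has to
    arrange for that. *)
Lemma zorn_subset {T : Type} (P : (T -> Prop) -> Prop) :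
  (forall F : (T -> Prop) -> Prop, (forall A, F A -> P A) ->
     (forall A B, F A -> F B -> (forall x, A x -> B x) \/ (forall x, B x -> A x)) ->
     P (fun x => exists A, F A /\ A x)) ->
  exists A, P A /\ forall B, P B -> (forall x, A x -> B x) -> forall x, B x -> A x.
Proof.
  intros H.
  destruct (@classical_sets.Zorn_bigcup T P) as [A [PA HA]].
  - intros F FP Ftot.
    match goal with |- P ?S => replace S with (fun x => exists A, F A /\ A x) end.
    + apply H; [exact FP|]. intros A B FA FB. exact (Ftot A B FA FB).
    + apply boolp.predeqP. intros x. split.
      * intros [A [FA Ax]]. exists A; [exact FA|exact Ax].
      * intros [A FA Ax]. exists A. split; [exact FA|exact Ax].
  - exists A. split; [exact PA|]. intros B PB AB x Bx.
    apply NNPP. intros nA. apply (HA B); [|exact PB].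
    split; [exact AB|]. intros BA. exact (nA (BA x Bx)).
Qed.

Definition embeds {K : Type} (S T : K -> Prop) : Prop :=
  exists f : K -> K, (forall x, S x -> T (f x)) /\
    forall x y, S x -> S y -> f x = f y -> x = y.

(** A maximal partial injection between [S] and [T] is total on [S] or onto [T]: a point missed on
    each side would give a pair to add. *)
Lemma embeds_total {K : Type} (S T : K -> Prop) : embeds S T \/ embeds T S.
Proof.
  set (good := fun h : K * K -> Prop =>
    (forall a b, h (a, b) -> S a /\ T b) /\
    (forall a b b', h (a, b) -> h (a, b') -> b = b') /\
    (forall a a' b, h (a, b) -> h (a', b) -> a = a')).
  destruct (zorn_subset good) as [h [[h1 [h2 h3]] hmax]].
  - intros F FP Ftot. split; [|split].
    + intros a b [A [FA Aab]]. exact (proj1 (FP A FA) a b Aab).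
    + intros a b b' [A [FA Aab]] [B [FB Bab]].
      destruct (Ftot A B FA FB) as [AB|BA].
      * destruct (FP B FB) as [_ [g _]]. eauto.
      * destruct (FP A FA) as [_ [g _]]. eauto.
    + intros a a' b [A [FA Aab]] [B [FB Bab]].
      destruct (Ftot A B FA FB) as [AB|BA].
      * destruct (FP B FB) as [_ [_ g]]. eauto.
      * destruct (FP A FA) as [_ [_ g]]. eauto.
  - destruct (classic (forall a, S a -> exists b, h (a, b))) as [tot|ntot].
    + left. destruct (classic (exists k : K, True)) as [[k0 _]|nk].
      * destruct (choice_on k0 _ _ tot) as [f hf]. exists f. split.
        -- intros x Sx. apply (h1 x). auto.
        -- intros x y Sx Sy e. apply (h3 x y (f x)); [auto|]. rewrite e. auto.
      * exists (fun x => x). split; [|auto]. intros x. exfalso. eauto.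
    + right. apply not_all_ex_not in ntot. destruct ntot as [a0 ntot].
      apply imply_to_and in ntot. destruct ntot as [Sa0 ntot].
      assert (sur : forall b, T b -> exists a, h (a, b)).
      { intros b Tb. apply NNPP. intros nb. apply ntot. exists b.
        apply (hmax (fun p => h p \/ p = (a0, b))).
        - split; [|split].
          + intros a b' [H|H]; [auto|]. inversion H; subst; auto.
          + intros a b1 b2 [H|H] [H'|H'].
            * eauto.
            * inversion H'; subst. exfalso. eauto.
            * inversion H; subst. exfalso. eauto.
            * inversion H; inversion H'; subst; auto.
          + intros a1 a2 b' [H|H] [H'|H'].
            * eauto.
            * inversion H'; subst. exfalso. eauto.
            * inversion H; subst. exfalso. eauto.
            * inversion H; inversion H'; subst; auto.
        - auto.
        - auto. }
      destruct (choice_on a0 _ _ sur) as [f hf]. exists f. split.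
      * intros x Tx. apply (h1 _ x). auto.
      * intros x y Tx Ty e. apply (h2 (f x)); [auto|]. rewrite e. auto.
Qed.

(** Zorn on graphs of injections from the square of [S] into [S], with [S] containing the range of
    [e]. If a maximal [S] embeds in its complement by [f], the graph extends to the union of [S] and
    its image, a contradiction. Otherwise the complement embeds in [S], so [K] embeds in two copies
    of [S] and hence in [S]. *)
Lemma square_embeds (K : Type) :
  (exists f : nat -> K, inj f) -> exists p : K * K -> K, inj p.
Proof.
  intros [e einj].
  set (good := fun h : (K * K) * K -> Prop =>
    exists S : K -> Prop,
    (forall a b c, h ((a, b), c) -> S a /\ S b /\ S c) /\
    (forall a b, S a -> S b -> exists c, h ((a, b), c)) /\
    (forall a b c c', h ((a, b), c) -> h ((a, b), c') -> c = c') /\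
    (forall a b a' b' c, h ((a, b), c) -> h ((a', b'), c) -> a = a' /\ b = b')).
  set (h0 := fun q : (K * K) * K =>
    exists i j, q = ((e i, e j), e (to_nat (i, j)))).
  assert (good0 : good h0).
  { exists (fun k => exists i, k = e i). split; [|split; [|split]].
    - intros a b c [i [j H]]. inversion H; subst. eauto 6.
    - intros a b [i ->] [j ->]. exists (e (to_nat (i, j))), i, j. reflexivity.
    - intros a b c c' [i [j H]] [i' [j' H']]. injection H as E1 E2 E3. injection H' as E1' E2' E3'.
      rewrite E1 in E1'. rewrite E2 in E2'. apply einj in E1'. apply einj in E2'. congruence.
    - intros a b a' b' c [i [j H]] [i' [j' H']]. injection H as E1 E2 E3. injection H' as E1' E2' E3'.
      rewrite E3 in E3'. apply einj in E3'.
      apply (to_nat_inj (i, j) (i', j')) in E3'. injection E3' as Ei Ej.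
      subst. auto. }
  (* Adding [h0] inside the predicate makes the empty chain admissible and forces [S] to contain the
     range of [e]. *)
  destruct (zorn_subset (fun h => good (fun q => h q \/ h0 q))) as [h1 [hgood hmax]].
  { intros F FP Ftot. destruct (classic (exists A, F A)) as [[A0 FA0]|nF].
    2:{ destruct good0 as [S [g1 [g2 [g3 g4]]]]. exists S. split; [|split; [|split]].
        - intros a b c [[A [FA _]]|H]; [exfalso; eauto|eauto].
        - intros a b Sa Sb. destruct (g2 a b Sa Sb) as [c hc]. eauto.
        - intros a b c c' [[A [FA _]]|H]; [exfalso; eauto|].
          intros [[A [FA _]]|H']; [exfalso; eauto|eauto].
        - intros a b a' b' c [[A [FA _]]|H]; [exfalso; eauto|].
          intros [[A [FA _]]|H']; [exfalso; eauto|eauto]. }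
    set (U := fun q => (exists A, F A /\ A q) \/ h0 q).
    assert (two : forall q q', U q -> U q' ->
      exists A, F A /\ (A q \/ h0 q) /\ (A q' \/ h0 q')).
    { intros q q' [[A [FA Aq]]|Hq] [[B [FB Bq]]|Hq'].
      - destruct (Ftot A B FA FB); [exists B|exists A]; auto.
      - exists A; auto.
      - exists B; auto.
      - exists A0; auto. }
    (* The set [S] of the union is recovered as the points whose diagonal pair lies in the
       domain. *)
    assert (diag : forall A a b c, F A -> A ((a, b), c) \/ h0 ((a, b), c) ->
      (exists c', U ((a, a), c')) /\ (exists c', U ((b, b), c')) /\
      (exists c', U ((c, c), c'))).
    { intros A a b c FA H. destruct (FP A FA) as [S [g1 [g2 [g3 g4]]]].
      destruct (g1 a b c H) as [Sa [Sb Sc]].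
      destruct (g2 a a Sa Sa) as [ca Ha]. destruct (g2 b b Sb Sb) as [cb Hb].
      destruct (g2 c c Sc Sc) as [cc Hc].
      split; [exists ca|split; [exists cb|exists cc]]; unfold U.
      - destruct Ha; eauto.
      - destruct Hb; eauto.
      - destruct Hc; eauto. }
    exists (fun k => exists c, U ((k, k), c)). split; [|split; [|split]].
    - intros a b c H. destruct (two _ _ H H) as [A [FA [H1 _]]]. eauto.
    - intros a b [c Ha] [c' Hb]. destruct (two _ _ Ha Hb) as [A [FA [H1 H2]]].
      destruct (FP A FA) as [S [g1 [g2 [g3 g4]]]].
      destruct (g2 a b) as [c'' Hc]; [apply (g1 _ _ _ H1)|apply (g1 _ _ _ H2)|].
      exists c''. destruct Hc; [left; eauto|right; auto].
    - intros a b c c' H H'. destruct (two _ _ H H') as [A [FA [H1 H2]]].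
      destruct (FP A FA) as [S [g1 [g2 [g3 g4]]]]. eauto.
    - intros a b a' b' c H H'. destruct (two _ _ H H') as [A [FA [H1 H2]]].
      destruct (FP A FA) as [S [g1 [g2 [g3 g4]]]]. eauto. }
  set (h := fun q => h1 q \/ h0 q) in hgood.
  assert (hM : forall g, good g -> (forall q, h q -> g q) -> forall q, g q -> h q).
  { intros g gg hg q gq. left. apply (hmax g); [|intros; apply hg; left; auto|exact gq].
    destruct gg as [S [g1 [g2 [g3 g4]]]]. exists S.
    assert (E : forall q, g q \/ h0 q -> g q).
    { intros q' [H|H]; [auto|]. apply hg. right. auto. }
    split; [|split; [|split]].
    - intros a b c H. apply (g1 a b c). auto.
    - intros a b Sa Sb. destruct (g2 a b Sa Sb) as [c Hc]. eauto.
    - intros a b c c' H H'. apply (g3 a b c c'); auto.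
    - intros a b a' b' c H H'. apply (g4 a b a' b' c); auto. }
  destruct hgood as [S [g1 [g2 [g3 g4]]]].
  assert (Se : forall i, S (e i)).
  { intros i. apply (g1 (e i) (e i) (e (to_nat (i, i)))). right. exists i, i. reflexivity. }
  assert (ene : forall i j, i <> j -> e i <> e j).
  { intros i j ij H. apply ij, einj, H. }
  destruct (choice_on (e 0%nat) (fun q : K * K => S (fst q) /\ S (snd q))
              (fun q c => h (q, c))) as [H hH].
  { intros [a b] [Sa Sb]. simpl in *. auto. }
  assert (HS : forall a b, S a -> S b -> S (H (a, b))).
  { intros a b Sa Sb. apply (g1 a b). apply hH. simpl; auto. }
  assert (Hinj : forall a b a' b', S a -> S b -> S a' -> S b' ->
             H (a, b) = H (a', b') -> a = a' /\ b = b').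
  { intros a b a' b' Sa Sb Sa' Sb' E. apply (g4 a b a' b' (H (a, b))).
    - apply hH; simpl; auto.
    - rewrite E. apply hH; simpl; auto. }
  destruct (embeds_total S (fun k => ~ S k)) as [[f [fT finj]]|[f [fS finj]]].
  - exfalso.
    destruct (choice_on (e 0%nat) (fun k => exists x, S x /\ f x = k)
                (fun k x => S x /\ f x = k)) as [u hu]; [auto|].
    (* [v] folds [S'] onto [S], at most two to one, and [tag] tells which components of a pair lie
       in [S]. Pairs with both components in [S] are excluded, so three tags suffice to undo the
       folding. *)
    set (v := fun a => if cdec (S a) then a else u a).
    set (tag := fun a b => if cdec (S a) then e 0%nat else
                           if cdec (S b) then e 1%nat else e 2%nat).
    set (S' := fun k => S k \/ exists x, S x /\ f x = k).
    assert (Sv : forall a, S' a -> S (v a)).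
    { intros a [Sa|Ha]; unfold v, cdec; destruct (excluded_middle_informative (S a));
        try tauto. apply hu; auto. }
    assert (vinj : forall a b, S' a -> S' b -> (S a <-> S b) -> v a = v b -> a = b).
    { intros a b Ha Hb ab. unfold v, cdec.
      destruct (excluded_middle_informative (S a));
      destruct (excluded_middle_informative (S b)); try tauto.
      intros E. destruct Ha as [Ha|Ha]; [tauto|]. destruct Hb as [Hb|Hb]; [tauto|].
      rewrite <- (proj2 (hu a Ha)), <- (proj2 (hu b Hb)), E. reflexivity. }
    assert (Stag : forall a b, S (tag a b)).
    { intros a b. unfold tag. destruct (cdec (S a)), (cdec (S b)); auto. }
    assert (taginj : forall a b a' b', ~ (S a /\ S b) -> ~ (S a' /\ S b') ->
               tag a b = tag a' b' -> (S a <-> S a') /\ (S b <-> S b')).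
    { intros a b a' b' nab nab'. unfold tag, cdec.
      destruct (excluded_middle_informative (S a));
      destruct (excluded_middle_informative (S b));
      destruct (excluded_middle_informative (S a'));
      destruct (excluded_middle_informative (S b')); intros E; try tauto;
      apply einj in E; discriminate. }
    (* New values lie in the image of [S] under [f], which is disjoint from [S], so they cannot
       collide with values of [h]. *)
    set (val := fun a b => f (H (tag a b, H (v a, v b)))).
    set (h' := fun q : (K * K) * K => h q \/
      (S' (fst (fst q)) /\ S' (snd (fst q)) /\ ~ (S (fst (fst q)) /\ S (snd (fst q))) /\
       snd q = val (fst (fst q)) (snd (fst q)))).
    assert (Sval : forall a b, S' a -> S' b -> S (H (tag a b, H (v a, v b)))).
    { intros a b Ha Hb. apply HS; [apply Stag|]. apply HS; apply Sv; auto. }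
    assert (g' : good h').
    { exists S'. split; [|split; [|split]].
      - intros a b c [Hh|[Ha [Hb [nab Hc]]]]; simpl in *.
        + destruct (g1 a b c Hh) as [? [? ?]]. unfold S'. auto.
        + split; [auto|split; [auto|]]. right. rewrite Hc. unfold val. eauto.
      - intros a b Ha Hb. destruct (classic (S a /\ S b)) as [[Sa Sb]|nab].
        + destruct (g2 a b Sa Sb) as [c Hc]. exists c. left. exact Hc.
        + exists (val a b). right. simpl. auto.
      - intros a b c c' [Hh|[Ha [Hb [nab Hc]]]] [Hh'|[Ha' [Hb' [nab' Hc']]]]; simpl in *.
        + eauto.
        + exfalso. apply nab'. destruct (g1 a b c Hh) as [? [? ?]]; auto.
        + exfalso. apply nab. destruct (g1 a b c' Hh') as [? [? ?]]; auto.
        + congruence.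
      - intros a b a' b' c [Hh|[Ha [Hb [nab Hc]]]] [Hh'|[Ha' [Hb' [nab' Hc']]]]; simpl in *.
        + eauto.
        + exfalso. destruct (g1 a b c Hh) as [? [? Sc]].
          rewrite Hc' in Sc. apply (fT _ (Sval a' b' Ha' Hb')). exact Sc.
        + exfalso. destruct (g1 a' b' c Hh') as [? [? Sc]].
          rewrite Hc in Sc. apply (fT _ (Sval a b Ha Hb)). exact Sc.
        + rewrite Hc in Hc'. apply finj in Hc'; [|auto|auto].
          apply Hinj in Hc'; auto. destruct Hc' as [E1 E2].
          apply Hinj in E2; auto. destruct E2 as [E2 E3].
          destruct (taginj _ _ _ _ nab nab' E1) as [? ?].
          split; apply vinj; auto. }
    assert (Ts : S' (f (e 0%nat))) by (right; eauto).
    assert (nT : ~ S (f (e 0%nat))) by (apply fT; auto).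
    (* By maximality [h'] is contained in [h], whose entries all lie in [S]; but [f (e 0)] occurs in
       [h']. *)
    apply nT.
    apply (g1 (f (e 0%nat)) (f (e 0%nat)) (val (f (e 0%nat)) (f (e 0%nat)))).
    apply (hM h' g').
    + intros q Hq. left. exact Hq.
    + right. simpl. tauto.
  (* The tags [e 0] and [e 1] keep [S] and its complement apart inside [S]. *)
  - set (g := fun x => if cdec (S x) then H (e 0%nat, x) else H (e 1%nat, f x)).
    assert (gS : forall x, S (g x)).
    { intros x. unfold g, cdec. destruct (excluded_middle_informative (S x)); auto. }
    assert (ginj : inj g).
    { intros x y. unfold g, cdec.
      destruct (excluded_middle_informative (S x));
      destruct (excluded_middle_informative (S y)); intros E; apply Hinj in E; auto;
      destruct E as [E1 E2]; auto; try (apply einj in E1; discriminate). }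
    exists (fun q => H (g (fst q), g (snd q))).
    intros [a b] [a' b'] E. simpl in E. apply Hinj in E; auto.
    destruct E as [E1 E2]. apply ginj in E1. apply ginj in E2. congruence.
Qed.

Definition emb (A B : Type) : Prop := exists f : A -> B, inj f.

Lemma emb_trans {A B C : Type} : emb A B -> emb B C -> emb A C.
Proof.
  intros [f hf] [g hg]. exists (fun x => g (f x)). intros x y E. apply hf, hg, E.
Qed.

Lemma emb_prod {A B A' B' : Type} : emb A A' -> emb B B' -> emb (A * B) (A' * B').
Proof.
  intros [f hf] [g hg]. exists (fun p => (f (fst p), g (snd p))).
  intros [a b] [a' b'] E. simpl in E. injection E as E1 E2.
  apply hf in E1. apply hg in E2. congruence.
Qed.

Lemma emb_list {A B : Type} : emb A B -> emb (list A) (list B).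
Proof.
  intros [f hf]. exists (map f). intros l. induction l as [|a l IH]; intros [|b m] E;
    try discriminate; [reflexivity|].
  simpl in E. injection E as E1 E2. apply hf in E1. apply IH in E2. congruence.
Qed.

Lemma emb_Z_nat : emb Z nat.
Proof.
  exists (fun z => if Z.leb 0 z then 2 * Z.to_nat z else 2 * Z.to_nat (- z) + 1)%nat.
  intros x y. destruct (Z.leb_spec 0 x), (Z.leb_spec 0 y); lia.
Qed.

(** The length is stored beside the nested pairs, which alone do not show where the unpacking
    stops. *)
Lemma emb_list_self (K : Type) : emb nat K -> emb (K * K) K -> emb (list K) K.
Proof.
  intros [e he] [p hp].
  exists (fun l => p (e (length l), fold_right (fun a acc => p (a, acc)) (e 0%nat) l)).
  intros l m E. apply hp in E. injection E as E1 E2. apply he in E1.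
  revert m E1 E2. induction l as [|a l IH]; intros [|b m] E1 E2; try discriminate;
    [reflexivity|].
  simpl in E1, E2. injection E1 as E1. apply hp in E2. injection E2 as E2 E3.
  rewrite E2, (IH m E1 E3). reflexivity.
Qed.

Lemma emb_seq_cantor (K : Type) : emb K (nat -> bool) -> emb (nat -> K) (nat -> bool).
Proof.
  intros [g hg]. exists (fun a n => g (a (fst (of_nat n))) (snd (of_nat n))).
  intros a b E. apply functional_extensionality. intros i. apply hg.
  apply functional_extensionality. intros j.
  apply (f_equal (fun h => h (to_nat (i, j)))) in E.
  rewrite cancel_of_to in E. exact E.
Qed.

(** Relative to [Q], so that it applies to a set of canonical representatives. [S] collects the
    points whose backward orbit ends outside the image of [Q] under [g]; [h] is [f] on [S] and
    inverts [g] elsewhere. *)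
Lemma cantor_bernstein {A C : Type} (Q : C -> Prop) (f : A -> C) (g : C -> A) :
  (forall a, Q (f a)) -> inj f ->
  (forall c c', Q c -> Q c' -> g c = g c' -> c = c') ->
  exists h : A -> C, (forall a, Q (h a)) /\ inj h /\ forall c, Q c -> exists a, h a = c.
Proof.
  intros Qf finj ginj.
  set (S := fun a => exists n a0, (forall c, Q c -> g c <> a0) /\
              a = Nat.iter n (fun x => g (f x)) a0).
  assert (step : forall a, S a -> S (g (f a))).
  { intros a [n [a0 [H1 H2]]]. exists (Datatypes.S n), a0. split; [exact H1|].
    simpl. rewrite <- H2. reflexivity. }
  assert (back : forall c, Q c -> S (g c) -> exists a, S a /\ f a = c).
  { intros c Qc [[|n] [a0 [H1 H2]]]; simpl in H2.
    - exfalso. apply (H1 c Qc H2).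
    - exists (Nat.iter n (fun x => g (f x)) a0). split; [exists n, a0; auto|].
      symmetry. apply ginj; auto. }
  assert (ex : forall a, exists c, Q c /\ ((S a /\ c = f a) \/ (~ S a /\ g c = a))).
  { intros a. destruct (classic (S a)) as [Sa|nSa]; [exists (f a); auto|].
    apply NNPP. intros N. apply nSa. exists 0%nat, a. split; [|reflexivity].
    intros c Qc E. apply N. exists c. auto. }
  destruct (choice _ ex) as [h hh]. exists h. split; [intros a; apply hh|split].
  - intros a a' E. destruct (hh a) as [Q1 [[S1 E1]|[S1 E1]]];
    destruct (hh a') as [Q2 [[S2 E2]|[S2 E2]]].
    + apply finj. congruence.
    + exfalso. apply S2. rewrite <- E2, <- E, E1. auto.
    + exfalso. apply S1. rewrite <- E1, E, E2. auto.
    + congruence.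
  - intros c Qc. destruct (classic (S (g c))) as [Sc|nSc].
    + destruct (back c Qc Sc) as [a [Sa E]]. exists a.
      destruct (hh a) as [_ [[_ E1]|[n _]]]; [congruence|tauto].
    + exists (g c). destruct (hh (g c)) as [Q1 [[S1 _]|[_ E1]]]; [tauto|auto].
Qed.

(** * Baire category in sequence spaces *)

Lemma half_pow_pos (n : nat) : 0 < (1/2) ^ n.
Proof. apply pow_lt. lra. Qed.

Lemma half_pow_le (m n : nat) : (m <= n)%nat -> (1/2) ^ n <= (1/2) ^ m.
Proof.
  induction 1 as [|n _ IH]; [lra|]. simpl. pose proof (half_pow_pos n). lra.
Qed.

Lemma half_pow_small (eps : R) : 0 < eps -> exists n, (1/2) ^ n < eps.
Proof.
  intros H. destruct (pow_lt_1_zero (1/2)) with (y := eps) as [N HN]; [|exact H|].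
  - rewrite Rabs_pos_eq; lra.
  - exists N. specialize (HN N (le_n N)). rewrite Rabs_pos_eq in HN; [exact HN|].
    left. apply half_pow_pos.
Qed.

Lemma least_witness (P : nat -> Prop) :
  (exists n, P n) -> exists n, P n /\ forall m, (m < n)%nat -> ~ P m.
Proof.
  intros H. destruct (dec_inh_nat_subset_has_unique_least_element P) as [n [[Hn Hm] _]].
  - intros n. apply classic.
  - exact H.
  - exists n. split; [exact Hn|]. intros m mn Pm. specialize (Hm m Pm). lia.
Qed.

Lemma strict_incr_le (n : nat -> nat) :
  (forall k, (n k < n (S k))%nat) -> forall k l, (k <= l)%nat -> (n k <= n l)%nat.
Proof. intros H k l. induction 1; [lia|]. specialize (H m). lia. Qed.

Lemma block_index (n : nat -> nat) : n 0%nat = 0%nat ->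
  (forall k, (n k < n (S k))%nat) ->
  exists blk : nat -> nat, forall i k, (n k <= i < n (S k))%nat <-> blk i = k.
Proof.
  intros n0 inc. pose proof (strict_incr_le n inc) as mono.
  assert (ge : forall k, (k <= n k)%nat).
  { induction k as [|k IH]; [lia|]. specialize (inc k). lia. }
  assert (ex : forall i, exists k, (n k <= i < n (S k))%nat).
  { intros i. destruct (least_witness (fun k => (i < n (S k))%nat)) as [k [H1 H2]].
    - exists i. specialize (ge (S i)). lia.
    - exists k. split; [|exact H1]. destruct k as [|k]; [lia|].
      specialize (H2 k (Nat.lt_succ_diag_r k)). lia. }
  destruct (choice _ ex) as [blk hb]. exists blk. intros i k. split.
  - intros H. specialize (hb i).
    destruct (Nat.lt_trichotomy (blk i) k) as [L|[E|L]]; [|exact E|].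
    + specialize (mono (S (blk i)) k L). lia.
    + specialize (mono (S k) (blk i) L). lia.
  - intros <-. apply hb.
Qed.

Definition agree {A : Type} (n : nat) (y z : nat -> A) : Prop :=
  forall i, (i < n)%nat -> y i = z i.

Section SeqSpace.
Context {A : Type}.

(** The exponent is the place of first difference; this ultrametric induces the product topology of
    discrete [A]. *)
Lemma seq_dist_exists : exists r : (nat -> A) -> (nat -> A) -> R, forall y z,
  (y = z /\ r y z = 0) \/ exists n, agree n y z /\ y n <> z n /\ r y z = (1/2) ^ n.
Proof.
  destruct (choice (fun (p : (nat -> A) * (nat -> A)) v =>
    (fst p = snd p /\ v = 0) \/
    exists n, agree n (fst p) (snd p) /\ fst p n <> snd p n /\ v = (1/2) ^ n)) as [r hr].
  - intros [y z]. simpl. destruct (classic (exists n, y n <> z n)) as [H|H].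
    + destruct (least_witness _ H) as [n [H1 H2]]. exists ((1/2) ^ n). right. exists n.
      split; [|auto]. intros i Hi. apply NNPP, H2, Hi.
    + exists 0. left. split; [|reflexivity]. apply functional_extensionality.
      intros i. apply NNPP. eauto.
  - exists (fun y z => r (y, z)). intros y z. apply (hr (y, z)).
Qed.

Definition seq_dist : (nat -> A) -> (nat -> A) -> R :=
  proj1_sig (constructive_indefinite_description _ seq_dist_exists).

Lemma seq_dist_spec (y z : nat -> A) :
  (y = z /\ seq_dist y z = 0) \/
  exists n, agree n y z /\ y n <> z n /\ seq_dist y z = (1/2) ^ n.
Proof. exact (proj2_sig (constructive_indefinite_description _ seq_dist_exists) y z). Qed.

Lemma seq_dist_ge (y z : nat -> A) (n : nat) : y n <> z n -> (1/2) ^ n <= seq_dist y z.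
Proof.
  intros H. destruct (seq_dist_spec y z) as [[-> _]|[m [H1 [_ ->]]]]; [tauto|].
  apply half_pow_le. destruct (Nat.le_gt_cases m n) as [L|L]; [exact L|].
  exfalso. apply H, H1, L.
Qed.

Lemma seq_dist_lt (y z : nat -> A) (n : nat) : seq_dist y z < (1/2) ^ n -> agree (S n) y z.
Proof.
  intros H i Hi. apply NNPP. intros N. apply seq_dist_ge in N.
  pose proof (half_pow_le i n). assert ((i <= n)%nat) by lia. specialize (H0 H1). lra.
Qed.

Lemma agree_seq_dist (y z : nat -> A) (n : nat) : agree n y z -> seq_dist y z <= (1/2) ^ n.
Proof.
  intros H. destruct (seq_dist_spec y z) as [[_ ->]|[m [H1 [H2 ->]]]].
  - left. apply half_pow_pos.
  - apply half_pow_le. destruct (Nat.le_gt_cases n m) as [L|L]; [exact L|].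
    exfalso. apply H2, H, L.
Qed.

Lemma seq_dist_metric : is_metric seq_dist.
Proof.
  assert (pos : forall y z, 0 <= seq_dist y z).
  { intros y z. destruct (seq_dist_spec y z) as [[_ ->]|[m [_ [_ ->]]]]; [lra|].
    left. apply half_pow_pos. }
  split; [exact pos|split; [|split]].
  - intros y z. destruct (seq_dist_spec y z) as [[E1 E2]|[m [_ [H E]]]]; [tauto|].
    rewrite E. pose proof (half_pow_pos m). split; [lra|]. intros ->. tauto.
  - assert (le : forall y z, seq_dist y z <= seq_dist z y).
    { intros y z. destruct (seq_dist_spec y z) as [[_ ->]|[m [_ [H ->]]]]; [apply pos|].
      apply seq_dist_ge. congruence. }
    intros y z. apply Rle_antisym; apply le.
  - intros x y z. pose proof (pos x y). pose proof (pos y z).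
    destruct (seq_dist_spec x z) as [[_ ->]|[m [_ [Hne ->]]]]; [lra|].
    destruct (classic (x m = y m)) as [E|N].
    + assert (N : y m <> z m) by congruence. apply seq_dist_ge in N. lra.
    + apply seq_dist_ge in N. lra.
Qed.

Lemma seq_dist_complete : complete seq_dist.
Proof.
  intros u Hu.
  destruct (choice (fun n N => forall m, (N <= m)%nat -> agree (S n) (u m) (u N))) as [N HN].
  { intros n. destruct (Hu ((1/2) ^ n) (half_pow_pos n)) as [N HN]. exists N.
    intros m Hm. apply seq_dist_lt. apply HN; lia. }
  exists (fun i => u (N i) i). intros eps Heps.
  destruct (half_pow_small eps Heps) as [k Hk].
  destruct (choice (fun k M => forall i, (i < k)%nat -> (N i <= M)%nat)) as [M HM].
  { induction x as [|x [M IH]]; [exists 0%nat; lia|]. exists (M + N x)%nat. intros i Hi.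
    destruct (Nat.eq_dec i x) as [->|ne]; [lia|]. specialize (IH i). lia. }
  exists (M k). intros n Hn. eapply Rle_lt_trans; [|exact Hk].
  apply agree_seq_dist. intros i Hi. apply HN; [|lia]. specialize (HM k i Hi). lia.
Qed.

Lemma separable_of_dense_seq {X : Type} (d : X -> X -> R) (e : nat -> X) :
  (forall x eps, 0 < eps -> exists n, d x (e n) < eps) -> separable d nat.
Proof.
  intros H. exists (fun x => exists n, e n = x). split.
  - intros x eps Heps. destruct (H x eps Heps) as [n Hn]. exists (e n). eauto.
  - destruct (choice (fun (s : {x | exists n, e n = x}) n => e n = proj1_sig s)) as [f hf].
    { intros [x Hx]. exact Hx. }
    exists f. intros [x Hx] [y Hy] E.
    assert (E' : x = y).
    { transitivity (e (f (exist _ x Hx))); [symmetry; apply (hf (exist _ x Hx))|].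
      rewrite E. apply (hf (exist _ y Hy)). }
    subst y. f_equal. apply proof_irrelevance.
Qed.

End SeqSpace.

Lemma testbit_prefix (h : nat -> bool) (k : nat) : exists n, agree k (Nat.testbit n) h.
Proof.
  revert h. induction k as [|k IH]; intros h; [exists 0%nat; intros i; lia|].
  destruct (IH (fun i => h (S i))) as [n Hn]. exists (2 * n + Nat.b2n (h 0%nat))%nat.
  intros [|i] Hi; [apply Nat.testbit_0_r|]. rewrite Nat.testbit_succ_r. apply Hn. lia.
Qed.

(** The binary digits of [n], even places for the first components and odd places for the second,
    run through all finite prefixes. *)
Lemma seq_bool2_separable : separable (@seq_dist (bool * bool)) nat.
Proof.
  apply (separable_of_dense_seq _
    (fun n i => (Nat.testbit n (2 * i), Nat.testbit n (2 * i + 1)))).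
  intros y eps Heps. destruct (half_pow_small eps Heps) as [k Hk].
  destruct (testbit_prefix (fun j => if Nat.even j then fst (y (Nat.div2 j))
                                     else snd (y (Nat.div2 j))) (2 * k)) as [n Hn].
  exists n. eapply Rle_lt_trans; [|exact Hk]. apply agree_seq_dist. intros i Hi.
  rewrite (Hn (2 * i)%nat), (Hn (2 * i + 1)%nat) by lia.
  replace (Nat.even (2 * i)) with true by (symmetry; apply Nat.even_spec; exists i; lia).
  replace (Nat.even (2 * i + 1)) with false.
  - replace (2 * i + 1)%nat with (S (2 * i)) by lia.
    rewrite Nat.div2_double, Nat.div2_succ_double. apply surjective_pairing.
  - rewrite Nat.add_1_r, Nat.even_succ. symmetry. rewrite <- Nat.negb_even.
    replace (Nat.even (2 * i)) with true; [reflexivity|].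
    symmetry; apply Nat.even_spec; exists i; lia.
Qed.

(* Talagrand's description of meager sets: a sequence that agrees with [x] on
   infinitely many blocks avoids [M]. *)
Lemma meager_blocks {A : Type} (lA : list A) (a0 : A) (M : (nat -> A) -> Prop) :
  (forall a, In a lA) -> meager seq_dist M ->
  exists (x : nat -> A) (n : nat -> nat), n 0%nat = 0%nat /\
    (forall k, (n k < n (S k))%nat) /\
    forall y, M y -> exists k0, forall k, (k0 <= k)%nat ->
      exists i, (n k <= i < n (S k))%nat /\ y i <> x i.
Proof.
  intros HA [N [Nnd MN]].
  (* Every cylinder has a subcylinder that misses a given nowhere dense set. *)
  assert (cyl : forall j z b, exists c w, (b <= c)%nat /\ agree b w z /\
            forall y, agree c y w -> ~ N j y).
  { intros j z b.
    destruct (classic (exists w, agree b w z /\ ~ closure seq_dist (N j) w))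
      as [[w [Hw ncl]]|nex].
    - apply not_all_ex_not in ncl. destruct ncl as [eps ncl].
      apply imply_to_and in ncl. destruct ncl as [Heps ncl].
      destruct (half_pow_small eps Heps) as [c Hc].
      exists (b + c)%nat, w. split; [lia|split; [exact Hw|]].
      intros y Hy Ny. apply ncl. exists y. split; [exact Ny|].
      eapply Rle_lt_trans; [|exact Hc]. apply agree_seq_dist. intros i Hi.
      symmetry. apply Hy. lia.
    - exfalso. apply (Nnd j (fun w => agree b w z)) with z.
      + intros w Hw. exists ((1/2) ^ b). split; [apply half_pow_pos|].
        intros v Hv i Hi. rewrite <- (Hw i Hi). symmetry.
        apply (seq_dist_lt w v b Hv). lia.
      + intros w Hw. apply NNPP. eauto.
      + intros i _. reflexivity. }
  assert (prefixes : forall a, exists L : list (nat -> A),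
            forall y, exists s, In s L /\ agree a y s).
  { induction a as [|a [L HL]].
    - exists ((fun _ => a0) :: nil). intros y. exists (fun _ => a0).
      split; [left; reflexivity|]. intros i Hi. lia.
    - exists (flat_map (fun s => map (fun v i => if Nat.eqb i a then v else s i) lA) L).
      intros y. destruct (HL y) as [s [Ls Hs]].
      exists (fun i => if Nat.eqb i a then y a else s i). split.
      + apply in_flat_map. exists s. split; [exact Ls|]. apply in_map_iff.
        exists (y a). split; [reflexivity|apply HA].
      + intros i Hi. destruct (Nat.eqb_spec i a) as [->|ne]; [reflexivity|].
        apply Hs. lia. }
  (* A single word on [a, b) has to work after every prefix of length [a]. These are finitely many,
     and the word is lengthened once for each. *)
  assert (step1 : forall j a, exists b w, (a < b)%nat /\
            forall y, (forall i, (a <= i < b)%nat -> y i = w i) -> ~ N j y).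
  { intros j a. destruct (prefixes a) as [L HL].
    assert (IL : forall L', exists b w, (a < b)%nat /\ forall s, In s L' ->
              forall y, agree a y s -> (forall i, (a <= i < b)%nat -> y i = w i) -> ~ N j y).
    { induction L' as [|s L' [b [w [ab IH]]]].
      - exists (S a), (fun _ => a0). split; [lia|]. intros s [].
      - destruct (cyl j (fun i => if Nat.ltb i a then s i else w i) b)
          as [c [z [bc [Hz Hc]]]].
        exists c, z. split; [lia|]. intros s' [<-|Hs'] y Hy1 Hy2.
        + apply Hc. intros i Hi. destruct (Nat.le_gt_cases a i) as [ai|ai]; [auto|].
          rewrite Hy1 by exact ai. rewrite (Hz i) by lia.
          destruct (Nat.ltb_spec i a); [reflexivity|lia].
        + apply (IH s' Hs' y Hy1). intros i Hi. rewrite Hy2 by lia.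
          rewrite (Hz i) by lia. destruct (Nat.ltb_spec i a); [lia|reflexivity]. }
    destruct (IL L) as [b [w [ab H]]]. exists b, w. split; [exact ab|].
    intros y Hy. destruct (HL y) as [s [Ls Hs]]. eapply H; eauto. }
  (* Block [k] handles [N 0] up to [N k] at once, so a point of [N j] differs from [x] on every
     block from [j] on. *)
  assert (step : forall p : nat * nat, exists q : nat * (nat -> A), (snd p < fst q)%nat /\
            forall j, (j <= fst p)%nat -> forall y,
              (forall i, (snd p <= i < fst q)%nat -> y i = snd q i) -> ~ N j y).
  { intros [k a]. simpl. induction k as [|k [[b w] [ab IH]]].
    - destruct (step1 0%nat a) as [b [w [ab H]]]. exists (b, w). simpl. split; [exact ab|].
      intros j Hj. replace j with 0%nat by lia. exact H.
    - simpl in *. destruct (step1 (S k) b) as [c [v [bc H]]].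
      exists (c, fun i => if Nat.ltb i b then w i else v i). simpl. split; [lia|].
      intros j Hj y Hy. destruct (Nat.eq_dec j (S k)) as [->|ne].
      + apply H. intros i Hi. rewrite Hy by lia. destruct (Nat.ltb_spec i b); [lia|reflexivity].
      + apply IH; [lia|]. intros i Hi. rewrite Hy by lia.
        destruct (Nat.ltb_spec i b); [reflexivity|lia]. }
  destruct (choice _ step) as [F HF].
  set (n := fix n k := match k with 0%nat => 0%nat | S k => fst (F (k, n k)) end).
  assert (inc : forall k, (n k < n (S k))%nat).
  { intros k. apply (HF (k, n k)). }
  destruct (block_index n eq_refl inc) as [blk hblk].
  exists (fun i => snd (F (blk i, n (blk i))) i), n. split; [reflexivity|split; [exact inc|]].
  intros y My. destruct (MN y My) as [j Nj]. exists j. intros k Hk. apply NNPP. intros no.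
  apply (proj2 (HF (k, n k)) j Hk y); [|exact Nj]. simpl. intros i Hi.
  apply NNPP. intros ne. apply no. exists i. split; [exact Hi|].
  rewrite (proj1 (hblk i k)) by exact Hi. exact ne.
Qed.

(** * One-dimensional chains modulo boundaries *)

(** A retraction onto [0,1]: paths are functions on all of R, but their continuity is known on [0,1]
    only. *)
Definition clamp (t : R) : R := Rmax 0 (Rmin 1 t).

Lemma clamp_in (t : R) : in_D1 (clamp t).
Proof.
  unfold clamp, in_D1, Rmax, Rmin. destruct (Rle_dec 1 t); destruct Rle_dec; lra.
Qed.

Lemma clamp_id (t : R) : in_D1 t -> clamp t = t.
Proof.
  unfold clamp, in_D1, Rmax, Rmin. destruct (Rle_dec 1 t); destruct Rle_dec; lra.
Qed.

Lemma clamp_below (t : R) : t <= 0 -> clamp t = 0.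
Proof.
  unfold clamp, in_D1, Rmax, Rmin. destruct (Rle_dec 1 t); destruct Rle_dec; lra.
Qed.

Lemma clamp_above (t : R) : 1 <= t -> clamp t = 1.
Proof.
  unfold clamp, in_D1, Rmax, Rmin. destruct (Rle_dec 1 t); destruct Rle_dec; lra.
Qed.

Lemma clamp_lip (t u : R) : Rabs (clamp t - clamp u) <= Rabs (t - u).
Proof.
  unfold clamp, Rmax, Rmin, Rabs.
  destruct (Rle_dec 1 t), (Rle_dec 1 u); repeat destruct Rle_dec; repeat destruct Rcase_abs; lra.
Qed.

Section Chains.
Context {X : Type}.

Definition ind (g s : R -> X) : Z := if cdec (same1 g s) then 1%Z else 0%Z.

Lemma same1_sym (g h : R -> X) : same1 g h -> same1 h g.
Proof. intros H t Ht. symmetry. apply H, Ht. Qed.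

Lemma same1_trans (g h k : R -> X) : same1 g h -> same1 h k -> same1 g k.
Proof. intros H H' t Ht. rewrite (H t Ht). apply H', Ht. Qed.

Lemma cdec_ext (P Q : Prop) : (P <-> Q) -> cdec P = cdec Q.
Proof.
  intros H. unfold cdec.
  destruct (excluded_middle_informative P), (excluded_middle_informative Q); tauto.
Qed.

Lemma ind_ext (g h s : R -> X) : same1 g h -> ind g s = ind h s.
Proof.
  intros H. unfold ind. rewrite (cdec_ext (same1 g s) (same1 h s)); [reflexivity|].
  split; intros H'.
  - exact (same1_trans _ _ _ (same1_sym _ _ H) H').
  - exact (same1_trans _ _ _ H H').
Qed.

Lemma coeff1_cons (z : Z) (g : R -> X) (c : chain1) (s : R -> X) :
  coeff1 ((z, g) :: c) s = (z * ind g s + coeff1 c s)%Z.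
Proof. unfold coeff1, ind. simpl. destruct (cdec (same1 g s)); lia. Qed.

Lemma coeff1_app (c c' : chain1) (s : R -> X) :
  coeff1 (c ++ c') s = (coeff1 c s + coeff1 c' s)%Z.
Proof.
  induction c as [|[z g] c IH]; [reflexivity|].
  rewrite <- app_comm_cons, !coeff1_cons, IH. lia.
Qed.

Lemma coeff1_bd2_cons (z : Z) (f : R -> R -> X) (m : chain2) (s : R -> X) :
  coeff1 (bd2 ((z, f) :: m)) s =
  (z * (ind (face0 f) s - ind (face1 f) s + ind (face2 f) s) + coeff1 (bd2 m) s)%Z.
Proof.
  change (bd2 ((z, f) :: m)) with
    ((z, face0 f) :: (Z.opp z, face1 f) :: (z, face2 f) :: bd2 m).
  rewrite !coeff1_cons. ring.
Qed.

Context (d : X -> X -> R) (Hmet : is_metric d).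

(** Chains are compared through their coefficient functions, so boundaries become a group of
    functions on paths and identities between chains reduce to [ring]. *)
Definition bounding (phi : (R -> X) -> Z) : Prop :=
  exists m, singular2 d m /\ forall s, phi s = coeff1 (bd2 m) s.

Lemma bounding_ext (phi psi : (R -> X) -> Z) :
  (forall s, psi s = phi s) -> bounding phi -> bounding psi.
Proof. intros E [m [H1 H2]]. exists m. split; [exact H1|]. intros s. rewrite E. apply H2. Qed.

Lemma bounding_0 : bounding (fun _ => 0%Z).
Proof. exists nil. split; [constructor|reflexivity]. Qed.

Lemma bounding_add (phi psi : (R -> X) -> Z) :
  bounding phi -> bounding psi -> bounding (fun s => phi s + psi s)%Z.
Proof.
  intros [m [H1 H2]] [m' [H1' H2']]. exists (m ++ m'). split.
  - apply Forall_app. auto.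
  - intros s. unfold bd2. rewrite flat_map_app. rewrite coeff1_app, H2, H2'. reflexivity.
Qed.

Lemma bounding_scale (z : Z) (phi : (R -> X) -> Z) :
  bounding phi -> bounding (fun s => z * phi s)%Z.
Proof.
  intros [m [H1 H2]]. exists (map (fun p => ((z * fst p)%Z, snd p)) m). split.
  - apply Forall_map. exact H1.
  - intros s. rewrite H2. clear. induction m as [|[y f] m IH].
    + simpl. unfold coeff1. simpl. lia.
    + simpl map. rewrite !coeff1_bd2_cons, <- IH. ring.
Qed.

Lemma bounding_sub (phi psi : (R -> X) -> Z) :
  bounding phi -> bounding psi -> bounding (fun s => phi s - psi s)%Z.
Proof.
  intros H H'. apply (bounding_ext (fun s => phi s + (-1) * psi s)%Z); [intros; ring|].
  apply bounding_add; [exact H|]. apply bounding_scale, H'.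
Qed.

Lemma homologous_refl (c : @chain1 X) : homologous d c c.
Proof. apply (bounding_ext (fun _ => 0%Z)); [intros; lia|apply bounding_0]. Qed.

Lemma homologous_sym (c c' : @chain1 X) : homologous d c c' -> homologous d c' c.
Proof.
  intros H. apply (bounding_ext (fun s => (-1) * (coeff1 c s - coeff1 c' s))%Z);
    [intros; ring|]. apply bounding_scale, H.
Qed.

Lemma homologous_trans (a b c : @chain1 X) :
  homologous d a b -> homologous d b c -> homologous d a c.
Proof.
  intros H H'.
  apply (bounding_ext (fun s => (coeff1 a s - coeff1 b s) + (coeff1 b s - coeff1 c s))%Z);
    [intros; ring|]. apply bounding_add; assumption.
Qed.

Definition seg (g : R -> X) (u v : R) : R -> X := fun t => g (u + (v - u) * t).

Lemma seg_in (u v t : R) : in_D1 u -> in_D1 v -> in_D1 t -> in_D1 (u + (v - u) * t).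
Proof. unfold in_D1. intros. nra. Qed.

Lemma Rabs_coef_le (a x : R) : -1 <= a <= 1 -> Rabs (a * x) <= Rabs x.
Proof.
  intros H. rewrite Rabs_mult. pose proof (Rabs_pos x).
  assert (Rabs a <= 1) by (unfold Rabs; destruct Rcase_abs; lra). nra.
Qed.

(* The singular triangle [g o phi], with [phi] affine sending the vertices to
   [u], [v], [w]. *)
Lemma bounding_triangle (g : R -> X) (u v w : R) :
  cont1 d g -> in_D1 u -> in_D1 v -> in_D1 w ->
  bounding (fun s => ind (seg g u v) s + ind (seg g v w) s - ind (seg g u w) s)%Z.
Proof.
  intros Hg Hu Hv Hw. unfold in_D1 in *.
  exists ((1%Z, fun a b => g (u + (v - u) * a + (w - u) * b)) :: nil). split.
  - constructor; [|constructor]. intros a b [Ha [Hb Hab]] eps Heps. simpl.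
    destruct (Hg (u + (v - u) * a + (w - u) * b)) with (eps := eps) as [delta [Hd H]];
      [split; nra|exact Heps|].
    exists delta. split; [exact Hd|]. intros a' b' [Ha' [Hb' Hab']] Hdist.
    apply H; [split; nra|].
    replace (u + (v - u) * a + (w - u) * b - (u + (v - u) * a' + (w - u) * b'))
      with ((v - u) * (a - a') + (w - u) * (b - b')) by ring.
    pose proof (Rabs_triang ((v - u) * (a - a')) ((w - u) * (b - b'))).
    pose proof (Rabs_coef_le (v - u) (a - a')). pose proof (Rabs_coef_le (w - u) (b - b')).
    lra.
  - intros s. rewrite coeff1_bd2_cons. unfold coeff1; simpl fold_right.
    rewrite (ind_ext (face0 _) (seg g v w)), (ind_ext (face1 _) (seg g u w)),
      (ind_ext (face2 _) (seg g u v)); [ring| | |];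
      intros t _; unfold face0, face1, face2, seg; f_equal; ring.
Qed.

Lemma seg_full (g : R -> X) : same1 (seg g 0 1) g.
Proof. intros t _. unfold seg. f_equal. ring. Qed.

Lemma bounding_seg_refl (g : R -> X) (u : R) :
  cont1 d g -> in_D1 u -> bounding (fun s => ind (seg g u u) s).
Proof.
  intros Hg Hu. eapply bounding_ext; [|exact (bounding_triangle g u u u Hg Hu Hu Hu)].
  intros s. simpl. ring.
Qed.

Lemma cont1_const (x : X) : cont1 d (fun _ => x).
Proof.
  intros t _ eps Heps. exists 1. split; [lra|]. intros _ _ _.
  destruct Hmet as [_ [H _]]. rewrite (proj2 (H x x) eq_refl). exact Heps.
Qed.

Lemma bounding_const (x : X) : bounding (fun s => ind (fun _ => x) s).
Proof.
  apply (bounding_seg_refl (fun _ => x) 0 (cont1_const x)). unfold in_D1; lra.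
Qed.

Lemma cont1_seg (g : R -> X) (u v : R) :
  cont1 d g -> in_D1 u -> in_D1 v -> cont1 d (seg g u v).
Proof.
  intros Hg Hu Hv t Ht eps Heps.
  destruct (Hg (u + (v - u) * t) (seg_in u v t Hu Hv Ht) eps Heps) as [delta [H1 H2]].
  exists delta. split; [exact H1|]. intros t' Ht' Hd. apply H2; [apply seg_in; assumption|].
  replace (u + (v - u) * t - (u + (v - u) * t')) with ((v - u) * (t - t')) by ring.
  eapply Rle_lt_trans; [apply Rabs_coef_le|exact Hd]. unfold in_D1 in *. lra.
Qed.

Definition rev_path (g : R -> X) : R -> X := seg g 1 0.

Lemma cont1_rev (g : R -> X) : cont1 d g -> cont1 d (rev_path g).
Proof. intros H. apply cont1_seg; [exact H| |]; unfold in_D1; lra. Qed.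

Lemma rev_path_0 (g : R -> X) : rev_path g 0 = g 1.
Proof. unfold rev_path, seg. f_equal. ring. Qed.

Lemma rev_path_1 (g : R -> X) : rev_path g 1 = g 0.
Proof. unfold rev_path, seg. f_equal. ring. Qed.

(** The triangle with vertices 1, 0, 1 gives the sum up to a constant path, which bounds a
    degenerate triangle. *)
Lemma bounding_rev (g : R -> X) :
  cont1 d g -> bounding (fun s => ind (rev_path g) s + ind g s)%Z.
Proof.
  intros Hg. assert (in_D1 0) by (unfold in_D1; lra). assert (in_D1 1) by (unfold in_D1; lra).
  eapply bounding_ext; [|apply bounding_add;
    [exact (bounding_triangle g 1 0 1 Hg H0 H H0)|exact (bounding_seg_refl g 1 Hg H0)]].
  intros s. simpl. rewrite (ind_ext _ _ s (seg_full g)). unfold rev_path. ring.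
Qed.

Definition concat (g h : R -> X) : R -> X :=
  fun t => if Rle_dec t (1/2) then g (2 * t) else h (2 * t - 1).

Lemma concat_0 (g h : R -> X) : concat g h 0 = g 0.
Proof. unfold concat. destruct Rle_dec; [f_equal; ring|lra]. Qed.

Lemma concat_1 (g h : R -> X) : concat g h 1 = h 1.
Proof. unfold concat. destruct Rle_dec; [lra|f_equal; ring]. Qed.

Lemma concat_in (g h : R -> X) (U : X -> Prop) :
  (forall t, in_D1 t -> U (g t)) -> (forall t, in_D1 t -> U (h t)) ->
  forall t, in_D1 t -> U (concat g h t).
Proof.
  unfold in_D1, concat. intros Hg Hh t Ht. destruct Rle_dec; [apply Hg|apply Hh]; lra.
Qed.

Lemma cont1_concat (g h : R -> X) :
  cont1 d g -> cont1 d h -> g 1 = h 0 -> cont1 d (concat g h).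
Proof.
  intros Hg Hh E t Ht eps Heps.
  destruct Hmet as [pos [zero [_ tri]]].
  destruct (Hg (clamp (2 * t)) (clamp_in _) (eps/2)) as [d1 [D1 H1]]; [lra|].
  destruct (Hh (clamp (2 * t - 1)) (clamp_in _) (eps/2)) as [d2 [D2 H2]]; [lra|].
  exists (Rmin d1 d2 / 2).
  pose proof (Rmin_l d1 d2). pose proof (Rmin_r d1 d2).
  split; [pose proof (Rmin_glb_lt d1 d2 0 D1 D2); lra|]. intros t' Ht' Hd.
  specialize (H1 (clamp (2 * t')) (clamp_in _)). specialize (H2 (clamp (2 * t' - 1)) (clamp_in _)).
  pose proof (clamp_lip (2 * t) (2 * t')) as L1.
  pose proof (clamp_lip (2 * t - 1) (2 * t' - 1)) as L2.
  replace (2 * t - 2 * t') with (2 * (t - t')) in L1 by ring.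
  replace (2 * t - 1 - (2 * t' - 1)) with (2 * (t - t')) in L2 by ring.
  rewrite Rabs_mult, (Rabs_pos_eq 2) in L1, L2 by lra.
  assert (G1 := H1 ltac:(lra)). assert (G2 := H2 ltac:(lra)). clear H1 H2.
  unfold concat, in_D1 in *.
  destruct (Rle_dec t (1/2)), (Rle_dec t' (1/2)).
  - rewrite !clamp_id in G1 by (unfold in_D1; lra). lra.
  - rewrite (clamp_id (2 * t)) in G1 by (unfold in_D1; lra).
    rewrite (clamp_above (2 * t')) in G1 by lra.
    rewrite (clamp_below (2 * t - 1)) in G2 by lra.
    rewrite (clamp_id (2 * t' - 1)) in G2 by (unfold in_D1; lra).
    specialize (tri (g (2 * t)) (g 1) (h (2 * t' - 1))). rewrite E in *. lra.
  - rewrite (clamp_id (2 * t')) in G1 by (unfold in_D1; lra).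
    rewrite (clamp_above (2 * t)) in G1 by lra.
    rewrite (clamp_below (2 * t' - 1)) in G2 by lra.
    rewrite (clamp_id (2 * t - 1)) in G2 by (unfold in_D1; lra).
    specialize (tri (h (2 * t - 1)) (g 1) (g (2 * t'))). rewrite E in *. lra.
  - rewrite !(clamp_id (_ - 1)) in G2 by (unfold in_D1; lra). lra.
Qed.

Lemma bounding_concat (g h : R -> X) :
  cont1 d g -> cont1 d h -> g 1 = h 0 ->
  bounding (fun s => ind (concat g h) s - ind g s - ind h s)%Z.
Proof.
  intros Hg Hh E. pose proof (cont1_concat g h Hg Hh E) as Hc.
  eapply bounding_ext; [|apply (bounding_scale (-1)),
    (bounding_triangle (concat g h) 0 (1/2) 1 Hc); unfold in_D1; lra].
  intros s. cbv beta. rewrite (ind_ext _ _ s (seg_full _)).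
  rewrite (ind_ext (seg (concat g h) 0 (1/2)) g), (ind_ext (seg (concat g h) (1/2) 1) h);
    [ring| |]; intros t [Ht0 Ht1]; unfold seg, concat; destruct Rle_dec; try lra.
  (* At time 1/2 [concat] still follows [g], so the second half starts at [g 1], which has to be
     identified with [h 0]. *)
  - assert (t = 0) as -> by lra. rewrite <- E. f_equal. field.
  - f_equal. field.
  - f_equal. field.
Qed.

End Chains.

(** * Locally null spaces *)

Section Counting.
Context {X : Type} (d : X -> X -> R) (Hmet : is_metric d).

Definition ball (a : X) (r : R) : X -> Prop := fun y => d a y < r.

Lemma ball_open (a : X) (r : R) : mopen d (ball a r).
Proof.
  intros x Hx. unfold ball in *. exists (r - d a x). split; [lra|]. intros y Hy.
  destruct Hmet as [_ [_ [_ tri]]]. specialize (tri a x y). lra.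
Qed.

Definition null_in (U : X -> Prop) : Prop :=
  forall g, cont1 d g -> g 0 = g 1 -> (forall t, in_D1 t -> U (g t)) ->
    bounding d (ind g).

Lemma null_in_paths (U : X -> Prop) (g h : R -> X) :
  null_in U -> cont1 d g -> cont1 d h -> g 0 = h 0 -> g 1 = h 1 ->
  (forall t, in_D1 t -> U (g t)) -> (forall t, in_D1 t -> U (h t)) ->
  bounding d (fun s => ind g s - ind h s)%Z.
Proof.
  intros HU Hg Hh E0 E1 Ug Uh.
  assert (Er : g 1 = rev_path h 0) by (rewrite rev_path_0; exact E1).
  pose proof (cont1_rev d h Hh) as Hr.
  assert (Hc : bounding d (ind (concat g (rev_path h)))).
  { apply HU.
    - apply cont1_concat; assumption.
    - rewrite concat_0, concat_1, rev_path_1. exact E0.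
    - apply concat_in; [exact Ug|]. intros t Ht. apply Uh. unfold in_D1 in *. lra. }
  pose proof (bounding_concat d Hmet g (rev_path h) Hg Hr Er) as H1.
  pose proof (bounding_rev d h Hh) as H2.
  eapply bounding_ext; [|exact (bounding_sub d _ _ (bounding_sub d _ _ Hc H1) H2)].
  intros s. cbv beta. ring.
Qed.

Context (D : X -> Prop) (Hdense : dense d D) (Hlpc : loc_path_connected d).

(** The path depends on the point alone, so the corrections at a point shared by several simplices
    are one and the same path and can cancel. *)
Lemma short_paths_to_dense (r : R) : 0 < r ->
  exists p : X -> R -> X, forall z, cont1 d (p z) /\ p z 0 = z /\ D (p z 1) /\
    forall t, in_D1 t -> d z (p z t) < r.
Proof.
  intros Hr. apply (choice (fun z g => cont1 d g /\ g 0 = z /\ D (g 1) /\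
    forall t, in_D1 t -> d z (g t) < r)). intros z.
  destruct (Hlpc z (ball z r)) as [V [Vo [Vz [VU Vp]]]].
  - apply ball_open.
  - unfold ball. destruct Hmet as [_ [H _]]. rewrite (proj2 (H z z) eq_refl). exact Hr.
  - destruct (Vo z Vz) as [eps [Heps He]]. destruct (Hdense z eps Heps) as [y [Dy Hy]].
    destruct (Vp z y Vz (He y Hy)) as [g [G1 [G2 [G3 G4]]]].
    exists g. split; [exact G1|split; [exact G2|split; [congruence|]]].
    intros t Ht. apply VU, G4, Ht.
Qed.

(** A Lebesgue number for [g]. The window in time puts a whole subinterval into one null ball; the
    margin [r] around its image leaves room for the short paths. *)
Definition scale_for (g : R -> X) (r : R) : Prop :=
  forall s, in_D1 s -> exists a n, D a /\ null_in (ball a ((1/2) ^ n)) /\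
    forall s', in_D1 s' -> Rabs (s' - s) < r -> forall y, d (g s') y < r ->
      ball a ((1/2) ^ n) y.

Lemma scale_for_le (g : R -> X) (r r' : R) : r' <= r -> scale_for g r -> scale_for g r'.
Proof.
  intros Hr H s Hs. destruct (H s Hs) as [a [n [H1 [H2 H3]]]]. exists a, n.
  split; [exact H1|split; [exact H2|]]. intros s' Hs' Hd y Hy. apply (H3 s'); lra || auto.
Qed.

Definition locally_null : Prop :=
  forall x, exists a n, D a /\ ball a ((1/2) ^ n) x /\ null_in (ball a ((1/2) ^ n)).

Context (Hnull : locally_null).

Lemma scale_exists (g : R -> X) : cont1 d g -> exists r, 0 < r /\ scale_for g r.
Proof.
  intros Hg.
  (* The window is [2 * rho] because compactness yields a [t] with [s] within [rho t] of it and
     [r <= rho t]; an [r]-window around [s] then fits. *)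
  destruct (choice (fun t (rho : posreal) => exists a n, D a /\
    null_in (ball a ((1/2) ^ n)) /\ forall s', in_D1 s' -> Rabs (s' - clamp t) < 2 * rho ->
      forall y, d (g s') y < rho -> ball a ((1/2) ^ n) y)) as [rho Hrho].
  - intros t. destruct (Hnull (g (clamp t))) as [a [n [Da [Hb Hn]]]]. unfold ball in Hb.
    destruct (Hg (clamp t) (clamp_in t) (((1/2) ^ n - d a (g (clamp t))) / 2))
      as [delta [Hd H]]; [lra|].
    set (eta := (1/2) ^ n - d a (g (clamp t))) in *.
    assert (Hrho : 0 < Rmin (delta / 2) (eta / 2)) by (apply Rmin_glb_lt; unfold eta; lra).
    exists (mkposreal _ Hrho), a, n. split; [exact Da|split; [exact Hn|]].
    simpl. intros s' Hs' Hdist y Hy.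
    pose proof (Rmin_l (delta / 2) (eta / 2)). pose proof (Rmin_r (delta / 2) (eta / 2)).
    rewrite Rabs_minus_sym in Hdist. specialize (H s' Hs' ltac:(lra)).
    destruct Hmet as [_ [_ [_ tri]]].
    pose proof (tri a (g (clamp t)) y). pose proof (tri (g (clamp t)) (g s') y).
    unfold ball. unfold eta in *. lra.
  - destruct (Compactness.compactness_value_1d 0 1 rho) as [r Hr].
    exists r. split; [apply cond_pos|]. intros s Hs.
    specialize (Hr s Hs). apply NNPP in Hr. destruct Hr as [t [Ht [Hst Hrt]]].
    destruct (Hrho t) as [a [n [Da [Hn H]]]]. exists a, n.
    split; [exact Da|split; [exact Hn|]]. intros s' Hs' Hd y Hy.
    apply (H s' Hs'); [|lra]. rewrite clamp_id by exact Ht.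
    replace (s' - t) with ((s' - s) + (s - t)) by ring.
    pose proof (Rabs_triang (s' - s) (s - t)). lra.
Qed.

Lemma scale_exists_chain (c : chain1) : singular1 d c ->
  exists r, 0 < r /\ Forall (fun q => scale_for (snd q) r) c.
Proof.
  induction 1 as [|q c Hq _ [r [Hr IH]]].
  - exists 1. split; [lra|constructor].
  - destruct (scale_exists _ Hq) as [r' [Hr' H]]. exists (Rmin r r').
    split; [apply Rmin_glb_lt; assumption|]. constructor.
    + apply (scale_for_le _ r'); [apply Rmin_r|exact H].
    + eapply Forall_impl; [|exact IH]. intros q'. apply scale_for_le, Rmin_l.
Qed.

Definition piece : Type := ((X * nat) * (R -> X))%type.

Definition valid_piece (q : piece) : Prop :=
  let '((a, n), w) := q in D a /\ null_in (ball a ((1/2) ^ n)) /\ cont1 d w /\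
    D (w 0) /\ D (w 1) /\ forall t, in_D1 t -> ball a ((1/2) ^ n) (w t).

Definition pieces_coeff (l : list piece) (s : R -> X) : Z :=
  fold_right (fun q acc => (ind (snd q) s + acc)%Z) 0%Z l.

(** Each subinterval is completed to a path between points of [D]: back along the short path at its
    left end, along [g], out along the short path at its right end. The corrections telescope to
    those at the two ends of [g]. *)
Lemma path_pieces (g : R -> X) (r : R) (p : X -> R -> X) :
  cont1 d g -> 0 < r -> scale_for g r ->
  (forall z, cont1 d (p z) /\ p z 0 = z /\ D (p z 1) /\
    forall t, in_D1 t -> d z (p z t) < r) ->
  exists l, Forall valid_piece l /\
    bounding d (fun s => ind g s - pieces_coeff l s - (ind (p (g 0%R)) s - ind (p (g 1%R)) s))%Z.
Proof.
  intros Hg Hr Hs Hp. destruct (archimed_cor1 r Hr) as [N [HN HN0]].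
  assert (HNR : 0 < INR N) by (apply lt_0_INR; exact HN0).
  assert (HNi : INR N * / INR N = 1) by (field; lra).
  assert (HNp : 0 < / INR N) by (apply Rinv_0_lt_compat; exact HNR).
  set (u := fun j => INR j * / INR N).
  assert (u0 : u 0%nat = 0) by (unfold u; simpl; ring).
  assert (uS : forall j, u (S j) = u j + / INR N) by (intros; unfold u; rewrite S_INR; ring).
  assert (uin : forall j, (j <= N)%nat -> in_D1 (u j)).
  { intros j Hj. apply le_INR in Hj. pose proof (pos_INR j). unfold u, in_D1. nra. }
  assert (step : forall j, (j <= N)%nat -> exists l, Forall valid_piece l /\
    bounding d (fun s => ind (seg g 0 (u j)) s - pieces_coeff l s -
                         (ind (p (g 0%R)) s - ind (p (g (u j))) s))%Z).
  { induction j as [|j IH]; intros Hj.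
    - exists nil. split; [constructor|]. rewrite u0.
      eapply bounding_ext; [|apply (bounding_seg_refl d g 0 Hg); unfold in_D1; lra].
      intros s. simpl. ring.
    - destruct IH as [l [Hl Hb]]; [lia|].
      assert (Hu : in_D1 (u j)) by (apply uin; lia).
      assert (Hu' : in_D1 (u (S j))) by (apply uin; lia).
      destruct (Hs (u j) Hu) as [a [n [Da [Hn Ha]]]].
      destruct (Hp (g (u j))) as [P1 [P2 [P3 P4]]].
      destruct (Hp (g (u (S j)))) as [Q1 [Q2 [Q3 Q4]]].
      set (gj := seg g (u j) (u (S j))).
      assert (Cg : cont1 d gj) by (apply cont1_seg; assumption).
      assert (G0 : gj 0 = g (u j)) by (unfold gj, seg; f_equal; ring).
      assert (G1 : gj 1 = g (u (S j))) by (unfold gj, seg; f_equal; ring).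
      pose proof (cont1_rev d _ P1) as Cr.
      assert (E1 : rev_path (p (g (u j))) 1 = gj 0) by (rewrite rev_path_1; congruence).
      pose proof (cont1_concat d Hmet _ _ Cr Cg E1) as C1.
      assert (E2 : concat (rev_path (p (g (u j)))) gj 1 = p (g (u (S j))) 0)
        by (rewrite concat_1; congruence).
      pose proof (cont1_concat d Hmet _ _ C1 Q1 E2) as C2.
      exists (((a, n), concat (concat (rev_path (p (g (u j)))) gj) (p (g (u (S j))))) :: l).
      split.
      + constructor; [|exact Hl]. split; [exact Da|split; [exact Hn|split; [exact C2|]]].
        split; [|split].
        * rewrite !concat_0, rev_path_0. exact P3.
        * rewrite concat_1. exact Q3.
        * assert (near : Rabs (u (S j) - u j) < r).
          { rewrite uS. rewrite Rabs_pos_eq; lra. }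
          assert (here : Rabs (u j - u j) < r) by (rewrite Rminus_diag, Rabs_R0; exact Hr).
          apply concat_in; [apply concat_in|].
          -- intros t Ht. apply (Ha (u j) Hu here). apply P4. unfold in_D1 in *. lra.
          -- intros t Ht. apply (Ha (u j + (u (S j) - u j) * t)).
             ++ apply seg_in; assumption.
             ++ replace (u j + (u (S j) - u j) * t - u j) with (t * (u (S j) - u j)) by ring.
                eapply Rle_lt_trans; [apply Rabs_coef_le|exact near]. unfold in_D1 in Ht; lra.
             ++ destruct Hmet as [_ [H _]]. unfold gj, seg.
                rewrite (proj2 (H _ _) eq_refl). exact Hr.
          -- intros t Ht. apply (Ha (u (S j)) Hu' near). apply Q4, Ht.
      + pose proof (bounding_concat d Hmet _ _ Cr Cg E1) as B1.
        pose proof (bounding_concat d Hmet _ _ C1 Q1 E2) as B2.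
        pose proof (bounding_rev d _ P1) as B3.
        assert (Z0 : in_D1 0) by (unfold in_D1; lra).
        pose proof (bounding_triangle d g 0 (u j) (u (S j)) Hg Z0 Hu Hu') as B4.
        eapply bounding_ext; [|exact (bounding_sub d _ _ (bounding_sub d _ _
          (bounding_sub d _ _ Hb B4) B1) (bounding_add d _ _ B2 B3))].
        intros s. cbn [pieces_coeff fold_right snd]. fold (pieces_coeff l s).
        fold gj. ring. }
  destruct (step N (le_n N)) as [l [Hl Hb]]. exists l. split; [exact Hl|].
  assert (uN : u N = 1) by exact HNi. rewrite uN in Hb.
  eapply bounding_ext; [|exact Hb]. intros s. cbv beta.
  rewrite (ind_ext _ _ s (seg_full g)). reflexivity.
Qed.

Definition family_coeff (L : list (Z * list piece)) (s : R -> X) : Z :=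
  fold_right (fun q acc => (fst q * pieces_coeff (snd q) s + acc)%Z) 0%Z L.

Definition valid_family (L : list (Z * list piece)) : Prop :=
  Forall (fun q => Forall valid_piece (snd q)) L.

(** Since [p z] starts at [z], it can equal [s] only for [z = s 0]. The sum of all corrections
    thereby becomes a boundary coefficient at [s 0]. *)
Lemma ind_start (p : X -> R -> X) (z : X) (s : R -> X) : (forall z, p z 0 = z) ->
  ind (p z) s = if cdec (same1 (p (s 0)) s) then (if cdec (z = s 0%R) then 1 else 0)%Z else 0%Z.
Proof.
  intros Hp. assert (Z0 : in_D1 0) by (unfold in_D1; lra). unfold ind, cdec.
  destruct (excluded_middle_informative (same1 (p z) s)) as [h|h];
  destruct (excluded_middle_informative (same1 (p (s 0)) s)) as [h'|h'];
  try destruct (excluded_middle_informative (z = s 0)) as [e|e]; try reflexivity.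
  - exfalso. apply e. rewrite <- (h 0 Z0). symmetry. apply Hp.
  - exfalso. apply h'. rewrite <- (h 0 Z0), Hp. exact h.
  - exfalso. apply h'. rewrite <- (h 0 Z0), Hp. exact h.
  - exfalso. apply h. rewrite e. exact h'.
Qed.

Lemma cycle_family (c : chain1) : cycle1 d c ->
  exists L, valid_family L /\ bounding d (fun s => coeff1 c s - family_coeff L s)%Z.
Proof.
  intros [Hc Hbd]. destruct (scale_exists_chain c Hc) as [r [Hr Hsc]].
  destruct (short_paths_to_dense r Hr) as [p Hp].
  (* The induction runs over chains that need not be cycles, so the boundary coefficient is carried
     along; it vanishes only at the end. *)
  assert (main : exists L, valid_family L /\ bounding d (fun s => coeff1 c s -
    family_coeff L s + if cdec (same1 (p (s 0%R)) s) then bd1coeff c (s 0%R) else 0)%Z).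
  { clear Hbd. induction c as [|[z g] c IH].
    - exists nil. split; [constructor|].
      eapply bounding_ext; [|apply bounding_0]. intros s. simpl. destruct cdec; reflexivity.
    - inversion Hc; subst. inversion Hsc; subst. cbn [fst snd] in *.
      destruct IH as [L [HL HB]]; [assumption|assumption|].
      destruct (path_pieces g r p) as [l [Hl Hb]]; try assumption.
      exists ((z, l) :: L). split; [constructor; assumption|].
      eapply bounding_ext; [|exact (bounding_add d _ _ HB (bounding_scale d z _ Hb))].
      intros s. rewrite coeff1_cons.
      rewrite !(ind_start p _ s) by (intros; apply Hp).
      cbn [family_coeff bd1coeff fold_right fst snd].
      fold (family_coeff L s). fold (bd1coeff c (s 0)).
      destruct (cdec (same1 (p (s 0)) s)), (cdec (g 0 = s 0)), (cdec (g 1 = s 0)); ring. }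
  destruct main as [L [HL HB]]. exists L. split; [exact HL|].
  eapply bounding_ext; [|exact HB]. intros s. cbv beta. rewrite Hbd.
  destruct cdec; ring.
Qed.

Context {K : Type} (kappa : X -> K)
  (Hkappa : forall x y, D x -> D y -> kappa x = kappa y -> x = y).

Definition piece_code (q : piece) : (K * nat) * (K * K) :=
  let '((a, n), w) := q in ((kappa a, n), (kappa (w 0), kappa (w 1))).

Definition family_code (L : list (Z * list piece)) :
  list (Z * list ((K * nat) * (K * K))) := map (fun q => (fst q, map piece_code (snd q))) L.

Lemma pieces_code_eq (l l' : list piece) :
  Forall valid_piece l -> Forall valid_piece l' -> map piece_code l = map piece_code l' ->
  bounding d (fun s => pieces_coeff l s - pieces_coeff l' s)%Z.
Proof.
  intros Hl. revert l'. induction Hl as [|[[a n] w] l V _ IH]; intros [|[[a' n'] w'] l'] V' E;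
    try discriminate.
  - eapply bounding_ext; [|apply bounding_0]. intros; reflexivity.
  - inversion V' as [|? ? V1 V2]; subst. simpl in E. injection E as E1 E2 E3 E4 E5.
    destruct V as [A1 [A2 [A3 [A4 [A5 A6]]]]]. destruct V1 as [B1 [B2 [B3 [B4 [B5 B6]]]]].
    subst n'. apply Hkappa in E1; auto. subst a'. apply Hkappa in E3; auto.
    apply Hkappa in E4; auto.
    pose proof (null_in_paths _ w w' A2 A3 B3 E3 E4 A6 B6) as H.
    eapply bounding_ext; [|exact (bounding_add d _ _ H (IH l' V2 E5))].
    intros s. cbn [pieces_coeff fold_right snd]. fold (pieces_coeff l s).
    fold (pieces_coeff l' s). ring.
Qed.

Lemma family_code_eq (L L' : list (Z * list piece)) :
  valid_family L -> valid_family L' -> family_code L = family_code L' ->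
  bounding d (fun s => family_coeff L s - family_coeff L' s)%Z.
Proof.
  intros HL. revert L'. induction HL as [|[z l] L V _ IH]; intros [|[z' l'] L'] V' E;
    try discriminate.
  - eapply bounding_ext; [|apply bounding_0]. intros; reflexivity.
  - inversion V' as [|? ? V1 V2]; subst. simpl in *. injection E as E1 E2 E3. subst z'.
    pose proof (pieces_code_eq l l' V V1 E2) as H.
    eapply bounding_ext; [|exact (bounding_add d _ _ (bounding_scale d z _ H) (IH L' V2 E3))].
    intros s. cbn [family_coeff fold_right fst snd]. fold (family_coeff L s).
    fold (family_coeff L' s). ring.
Qed.

Lemma locally_null_H1_card_le : (exists e : nat -> K, inj e) -> H1_card_le d K.
Proof.
  intros Kinf. pose proof (square_embeds K Kinf) as Ksq.
  assert (code : emb (list (Z * list ((K * nat) * (K * K)))) K).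
  { assert (id : emb K K) by (exists (fun k => k); intros x y E; exact E).
    assert (items : emb (list ((K * nat) * (K * K))) K).
    { apply (emb_trans (B := list K)); [|apply emb_list_self; assumption].
      apply emb_list. apply (emb_trans (B := (K * K)%type)); [|exact Ksq].
      apply emb_prod; [|exact Ksq].
      apply (emb_trans (B := (K * K)%type)); [|exact Ksq]. apply emb_prod; assumption. }
    apply (emb_trans (B := list K)); [|apply emb_list_self; assumption].
    apply emb_list. apply (emb_trans (B := (K * K)%type)); [|exact Ksq].
    apply emb_prod; [|exact items]. exact (emb_trans emb_Z_nat Kinf). }
  destruct code as [code Hcode].
  destruct (choice_on nil (cycle1 d) (fun c L => valid_family L /\
    bounding d (fun s => coeff1 c s - family_coeff L s)%Z) cycle_family) as [F HF].
  exists (fun c => code (family_code (F c))). intros c c' Hc Hc' E. apply Hcode in E.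
  destruct (HF c Hc) as [V B]. destruct (HF c' Hc') as [V' B'].
  pose proof (family_code_eq _ _ V V' E) as H.
  eapply bounding_ext; [|exact (bounding_add d _ _ (bounding_sub d _ _ B B') H)].
  intros s. cbv beta. ring.
Qed.

End Counting.

(** * Wedges of small essential loops *)

Section Wedge.
Context {X : Type} (d : X -> X -> R) (Hmet : is_metric d).

(** The point [x0] lies in no null ball centred in [D], so there are essential loops in small balls
    near it. They need not pass through [x0] and are conjugated by a path inside a path connected
    neighbourhood. *)
Lemma essential_loops (D : X -> Prop) :
  dense d D -> loc_path_connected d -> ~ locally_null d D ->
  exists x0, exists l : nat -> R -> X, forall n, cont1 d (l n) /\ l n 0 = x0 /\ l n 1 = x0 /\
    (forall t, in_D1 t -> d x0 (l n t) < (1/2) ^ n) /\ ~ bounding d (ind (l n)).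
Proof.
  intros Hdense Hlpc Hnn. destruct Hmet as [pos [zero [sym tri]]].
  apply not_all_ex_not in Hnn. destruct Hnn as [x0 Hx0]. exists x0.
  apply (choice (fun n g => cont1 d g /\ g 0 = x0 /\ g 1 = x0 /\
    (forall t, in_D1 t -> d x0 (g t) < (1/2) ^ n) /\ ~ bounding d (ind g))).
  intros n.
  destruct (Hlpc x0 (ball d x0 ((1/2) ^ n))) as [V [Vo [Vx [VU Vp]]]].
  { apply ball_open. exact Hmet. }
  { unfold ball. rewrite (proj2 (zero x0 x0) eq_refl). apply half_pow_pos. }
  destruct (Vo x0 Vx) as [eps [Heps He]].
  (* A point of the ball is within [(1/2) ^ k] of [a], which is itself that close to [x0]; half of
     [eps] keeps the ball inside [V]. *)
  destruct (half_pow_small (eps / 2)) as [k Hk]; [lra|].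
  destruct (Hdense x0 ((1/2) ^ k) (half_pow_pos k)) as [a [Da Ha]].
  assert (nn : ~ null_in d (ball d a ((1/2) ^ k))).
  { intros N. apply Hx0. exists a, k. split; [exact Da|split; [|exact N]].
    unfold ball. rewrite sym. exact Ha. }
  apply not_all_ex_not in nn. destruct nn as [g nn].
  apply imply_to_and in nn. destruct nn as [Cg nn].
  apply imply_to_and in nn. destruct nn as [E nn].
  apply imply_to_and in nn. destruct nn as [Bg nn].
  assert (Vg : forall t, in_D1 t -> V (g t)).
  { intros t Ht. apply He. specialize (Bg t Ht). unfold ball in Bg.
    specialize (tri x0 a (g t)). lra. }
  assert (Z0 : in_D1 0) by (unfold in_D1; lra).
  destruct (Vp x0 (g 0) Vx (Vg 0 Z0)) as [p [Cp [P0 [P1 Pv]]]].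
  pose proof (cont1_concat d Hmet p g Cp Cg P1) as C1.
  assert (E1 : concat p g 1 = rev_path p 0) by (rewrite concat_1, rev_path_0; congruence).
  pose proof (cont1_rev d p Cp) as Cr.
  pose proof (cont1_concat d Hmet _ _ C1 Cr E1) as C2.
  exists (concat (concat p g) (rev_path p)). split; [exact C2|split; [|split; [|split]]].
  - rewrite !concat_0. exact P0.
  - rewrite concat_1, rev_path_1. exact P0.
  - intros t Ht. apply VU. revert t Ht. apply concat_in; [apply concat_in; assumption|].
    intros t Ht. apply Pv. unfold in_D1 in *. lra.
  - intros B. apply nn.
    pose proof (bounding_concat d Hmet p g Cp Cg P1) as B1.
    pose proof (bounding_concat d Hmet _ _ C1 Cr E1) as B2.
    pose proof (bounding_rev d p Cp) as B3.
    eapply bounding_ext; [|exact (bounding_sub d _ _ (bounding_sub d _ _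
      (bounding_sub d _ _ B B2) B1) B3)].
    intros s. cbv beta. ring.
Qed.

Context (x0 : X) (l : nat -> R -> X)
  (Hl : forall n, cont1 d (l n) /\ l n 0 = x0 /\ l n 1 = x0 /\
    (forall t, in_D1 t -> d x0 (l n t) < (1/2) ^ n)).

(** The interval from [knot n] to [knot (S n)] is reserved for [l n]. *)
Definition knot (n : nat) : R := 1 - (1/2) ^ n.

Lemma knot_in (n : nat) : in_D1 (knot n).
Proof.
  unfold knot, in_D1. pose proof (half_pow_pos n). pose proof (half_pow_le 0 n).
  simpl in H0. specialize (H0 (Nat.le_0_l n)). lra.
Qed.

Lemma knot_S (n : nat) : knot (S n) = knot n + (1/2) ^ S n.
Proof. unfold knot. simpl. lra. Qed.

Lemma knot_le (m n : nat) : (m <= n)%nat -> knot m <= knot n.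
Proof. intros H. apply half_pow_le in H. unfold knot. lra. Qed.

Definition petal (n : nat) (t : R) : X := l n (clamp ((t - knot n) / (1/2) ^ S n)).

Lemma petal_support (n : nat) (t : R) : petal n t <> x0 -> knot n < t < knot (S n).
Proof.
  intros H. destruct (Hl n) as [_ [H0 [H1 _]]]. pose proof (half_pow_pos (S n)) as Hw.
  rewrite knot_S. unfold petal in H. set (w := (1/2) ^ S n) in *.
  split; apply Rnot_le_lt; intros L; apply H.
  - rewrite clamp_below; [exact H0|].
    apply (Rmult_le_reg_r w); [exact Hw|].
    replace ((t - knot n) / w * w) with (t - knot n) by (field; lra). lra.
  - rewrite clamp_above; [exact H1|].
    apply (Rmult_le_reg_r w); [exact Hw|].
    replace ((t - knot n) / w * w) with (t - knot n) by (field; lra). lra.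
Qed.

Lemma petal_disjoint (n m : nat) (t : R) :
  petal n t <> x0 -> knot m <= t <= knot (S m) -> n = m.
Proof.
  intros H Hm. apply petal_support in H.
  destruct (Nat.lt_trichotomy n m) as [L|[E|L]]; [|exact E|]; exfalso.
  - apply (knot_le (S n) m) in L. lra.
  - apply (knot_le (S m) n) in L. lra.
Qed.

Lemma petal_unique (n m : nat) (t : R) : petal n t <> x0 -> petal m t <> x0 -> n = m.
Proof.
  intros H H'. apply petal_support in H'. apply (petal_disjoint n m t H). lra.
Qed.

(** One [delta] serves all [n]: from some index on, the petals stay within [eps / 2] of [x0]. This
    yields continuity of the wedge also at time 1, where the intervals accumulate. *)
Lemma petal_equicont (t eps : R) : 0 < eps -> exists delta, 0 < delta /\
  forall n t', Rabs (t - t') < delta -> d (petal n t) (petal n t') < eps.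
Proof.
  intros Heps. destruct Hmet as [pos [zero [sym tri]]].
  destruct (half_pow_small (eps / 2)) as [N HN]; [lra|].
  assert (fin : forall k, exists delta, 0 < delta /\ forall n t', (n < k)%nat ->
    Rabs (t - t') < delta -> d (petal n t) (petal n t') < eps).
  { induction k as [|k [d1 [D1 H1]]]; [exists 1; split; [lra|lia]|].
    destruct (Hl k) as [Ck _].
    destruct (Ck _ (clamp_in ((t - knot k) / (1/2) ^ S k)) eps Heps) as [d2 [D2 H2]].
    pose proof (half_pow_pos (S k)) as Hw. set (w := (1/2) ^ S k) in *.
    exists (Rmin d1 (d2 * w)). split.
    - apply Rmin_glb_lt; [exact D1|]. apply Rmult_lt_0_compat; assumption.
    - intros n t' Hn Ht. destruct (Nat.eq_dec n k) as [->|ne].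
      + apply (H2 _ (clamp_in _)). eapply Rle_lt_trans; [apply clamp_lip|]. fold w.
        replace ((t - knot k) / w - (t' - knot k) / w) with ((t - t') / w) by (field; lra).
        unfold Rdiv. rewrite Rabs_mult, (Rabs_pos_eq (/ w))
          by (left; apply Rinv_0_lt_compat; exact Hw).
        apply (Rmult_lt_reg_r w); [exact Hw|].
        rewrite Rmult_assoc, Rinv_l by lra. pose proof (Rmin_r d1 (d2 * w)). lra.
      + apply H1; [lia|]. pose proof (Rmin_l d1 (d2 * w)). lra. }
  destruct (fin N) as [delta [Hd H]]. exists delta. split; [exact Hd|].
  intros n t' Ht. destruct (Nat.lt_ge_cases n N) as [L|L]; [apply H; assumption|].
  destruct (Hl n) as [_ [_ [_ Hn]]]. apply half_pow_le in L. unfold petal.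
  pose proof (Hn _ (clamp_in ((t - knot n) / (1/2) ^ S n))) as A.
  pose proof (Hn _ (clamp_in ((t' - knot n) / (1/2) ^ S n))) as B.
  rewrite sym in A. eapply Rle_lt_trans; [apply (tri _ x0)|]. lra.
Qed.

Lemma wedge_exists : exists L : (nat -> bool) -> R -> X, forall b t,
  (exists n, b n = true /\ petal n t <> x0 /\ L b t = petal n t) \/
  ((forall n, b n = true -> petal n t = x0) /\ L b t = x0).
Proof.
  destruct (choice (fun (p : (nat -> bool) * R) x =>
    (exists n, fst p n = true /\ petal n (snd p) <> x0 /\ x = petal n (snd p)) \/
    ((forall n, fst p n = true -> petal n (snd p) = x0) /\ x = x0))) as [L HL].
  - intros [b t]. simpl. destruct (classic (exists n, b n = true /\ petal n t <> x0))
      as [[n [H1 H2]]|H].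
    + exists (petal n t). left. eauto.
    + exists x0. right. split; [|reflexivity]. intros n Hn. apply NNPP. eauto.
  - exists (fun b t => L (b, t)). intros b t. apply (HL (b, t)).
Qed.

(* The infinite concatenation of the loops [l n] with [b n = true]. *)
Definition wedge : (nat -> bool) -> R -> X :=
  proj1_sig (constructive_indefinite_description _ wedge_exists).

Lemma wedge_spec (b : nat -> bool) (t : R) :
  (exists n, b n = true /\ petal n t <> x0 /\ wedge b t = petal n t) \/
  ((forall n, b n = true -> petal n t = x0) /\ wedge b t = x0).
Proof. exact (proj2_sig (constructive_indefinite_description _ wedge_exists) b t). Qed.

Lemma wedge_on (b : nat -> bool) (n : nat) (t : R) : knot n <= t <= knot (S n) ->
  wedge b t = if b n then petal n t else x0.
Proof.
  intros Ht. destruct (wedge_spec b t) as [[m [H1 [H2 H3]]]|[H1 H2]].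
  - rewrite <- (petal_disjoint m n t H2 Ht), H1. exact H3.
  - destruct (b n) eqn:E; [rewrite (H1 n E)|]; exact H2.
Qed.

(** Makes evaluation at a fixed time continuous in [b], on which the closedness of the codes
    relies. *)
Lemma wedge_local (t : R) : exists n, forall b b', b n = b' n -> wedge b t = wedge b' t.
Proof.
  destruct (classic (exists n, petal n t <> x0)) as [[n Hn]|no].
  - exists n. intros b b' E. pose proof (petal_support n t Hn).
    rewrite (wedge_on b n t), (wedge_on b' n t) by lra. rewrite E. reflexivity.
  - exists 0%nat. intros b b' _.
    destruct (wedge_spec b t) as [[m [_ [H2 _]]]|[_ ->]]; [exfalso; eauto|].
    destruct (wedge_spec b' t) as [[m [_ [H2 _]]]|[_ ->]]; [exfalso; eauto|reflexivity].
Qed.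

Lemma cont1_wedge (b : nat -> bool) : cont1 d (wedge b).
Proof.
  intros t _ eps Heps. destruct (petal_equicont t (eps / 2)) as [delta [Hd H]]; [lra|].
  exists delta. split; [exact Hd|]. intros t' _ Ht. destruct Hmet as [pos [zero [sym tri]]].
  destruct (wedge_spec b t) as [[n [Bn [Pn ->]]]|[Hn ->]];
  destruct (wedge_spec b t') as [[m [Bm [Pm ->]]]|[Hm ->]].
  - destruct (Nat.eq_dec n m) as [<-|ne]; [specialize (H n t' Ht); lra|].
    (* For distinct petals both points are compared with [x0]: petal [n] rests there at time [t'],
       and petal [m] at time [t]. *)
    pose proof (H n t' Ht) as A. pose proof (H m t' Ht) as B.
    assert (E : petal n t' = x0).
    { apply NNPP. intros N. apply ne, (petal_unique n m t'); assumption. }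
    assert (E' : petal m t = x0).
    { apply NNPP. intros N. apply ne, (petal_unique n m t); assumption. }
    rewrite E in A. rewrite E' in B. specialize (tri (petal n t) x0 (petal m t')). lra.
  - rewrite <- (Hm n Bn). specialize (H n t' Ht). lra.
  - rewrite <- (Hn m Bm). specialize (H m t' Ht). lra.
  - rewrite (proj2 (zero x0 x0) eq_refl). exact Heps.
Qed.

Lemma wedge_ends (b : nat -> bool) : wedge b 0 = x0 /\ wedge b 1 = x0.
Proof.
  assert (H : forall t, t <= 0 \/ 1 <= t -> wedge b t = x0).
  { intros t Ht. destruct (wedge_spec b t) as [[n [_ [H _]]]|[_ H]]; [exfalso|exact H].
    apply petal_support in H. pose proof (knot_in n). pose proof (knot_in (S n)).
    unfold in_D1 in *. lra. }
  split; apply H; lra.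
Qed.

(** Both paths are cut at [knot n] and [knot (S n)]. The outer pieces coincide; the middle ones are
    [l n] and a constant, which bounds. *)
Lemma wedge_flip (b b' : nat -> bool) (n : nat) :
  (forall m, m <> n -> b m = b' m) -> b n = true -> b' n = false ->
  bounding d (fun s => ind (wedge b) s - ind (wedge b') s - ind (l n) s)%Z.
Proof.
  intros Hbb Hb Hb'.
  assert (Z0 : in_D1 0) by (unfold in_D1; lra). assert (Z1 : in_D1 1) by (unfold in_D1; lra).
  pose proof (knot_in n) as Hk. pose proof (knot_in (S n)) as Hk'.
  pose proof (half_pow_pos (S n)) as Hw.
  assert (split3 : forall c, bounding d (fun s => ind (seg (wedge c) 0 (knot n)) s +
    ind (seg (wedge c) (knot n) (knot (S n))) s + ind (seg (wedge c) (knot (S n)) 1) s -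
    ind (wedge c) s)%Z).
  { intros c. pose proof (cont1_wedge c) as Cc.
    pose proof (bounding_triangle d _ 0 (knot n) (knot (S n)) Cc Z0 Hk Hk') as B1.
    pose proof (bounding_triangle d _ 0 (knot (S n)) 1 Cc Z0 Hk' Z1) as B2.
    eapply bounding_ext; [|exact (bounding_add d _ _ B1 B2)].
    intros s. cbv beta. rewrite (ind_ext (seg (wedge c) 0 1) _ s (seg_full _)). ring. }
  assert (off : forall t, t <= knot n \/ knot (S n) <= t -> wedge b t = wedge b' t).
  { intros t Ht. destruct (wedge_spec b t) as [[m [Bm [Pm ->]]]|[Hm ->]];
    pose proof (knot_S n).
    - pose proof (petal_support m t Pm). assert (m <> n) by (intros ->; lra).
      rewrite (wedge_on b' m t) by lra. rewrite <- Hbb, Bm by assumption. reflexivity.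
    - destruct (wedge_spec b' t) as [[m [Bm [Pm ->]]]|[_ ->]]; [|reflexivity].
      pose proof (petal_support m t Pm). assert (m <> n) by (intros ->; lra).
      symmetry. apply Hm. rewrite Hbb; assumption. }
  eapply bounding_ext; [|exact (bounding_sub d _ _ (bounding_sub d _ _ (split3 b') (split3 b))
    (bounding_const d Hmet x0))].
  intros s. cbv beta.
  rewrite (ind_ext (seg (wedge b) 0 (knot n)) (seg (wedge b') 0 (knot n))).
  2:{ intros t Ht. apply off. left. unfold in_D1 in *. nra. }
  rewrite (ind_ext (seg (wedge b) (knot (S n)) 1) (seg (wedge b') (knot (S n)) 1)).
  2:{ intros t Ht. apply off. right. unfold in_D1 in *. nra. }
  assert (on : forall t, in_D1 t ->
    knot n <= knot n + (knot (S n) - knot n) * t <= knot (S n)).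
  { intros t Ht. rewrite knot_S. unfold in_D1 in *. nra. }
  rewrite (ind_ext (seg (wedge b) (knot n) (knot (S n))) (l n)).
  2:{ intros t Ht. unfold seg. rewrite (wedge_on b n) by (apply on, Ht). rewrite Hb.
      unfold petal. rewrite knot_S.
      replace ((knot n + (knot n + (1/2) ^ S n - knot n) * t - knot n) / (1/2) ^ S n) with t
        by (field; lra).
      rewrite clamp_id by exact Ht. reflexivity. }
  rewrite (ind_ext (seg (wedge b') (knot n) (knot (S n))) (fun _ => x0)).
  2:{ intros t Ht. unfold seg. rewrite (wedge_on b' n) by (apply on, Ht). rewrite Hb'.
      reflexivity. }
  ring.
Qed.

End Wedge.

(** * Suslin projections and codes for singular triangles *)

Lemma bound_on_list {A : Type} (h : A -> nat) (l : list A) :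
  exists M, forall a, In a l -> (h a < M)%nat.
Proof.
  induction l as [|a l [M IH]]; [exists 0%nat; intros a []|].
  exists (S (M + h a)). intros b [<-|Hb]; [lia|]. specialize (IH b Hb). lia.
Qed.

Lemma Rle_of_small (a b : R) : (forall eps, 0 < eps -> a <= b + eps) -> a <= b.
Proof.
  intros H. apply Rnot_lt_le. intros L. specialize (H ((a - b) / 2)). lra.
Qed.

Section Projection.
Context {X K : Type} (d : X -> X -> R) (Hmet : is_metric d) (Hcomp : complete d).

Lemma fast_limit (a : nat -> X) :
  (forall j k, d (a j) (a k) <= (1/2) ^ j + (1/2) ^ k) ->
  exists x, forall j, d (a j) x <= (1/2) ^ j.
Proof.
  intros Ha. destruct Hmet as [pos [zero [sym tri]]]. destruct (Hcomp a) as [x Hx].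
  - intros eps Heps. destruct (half_pow_small (eps / 2)) as [N HN]; [lra|]. exists N.
    intros m n Hm Hn. specialize (Ha m n). apply half_pow_le in Hm, Hn. lra.
  - exists x. intros j. apply Rle_of_small. intros eps Heps.
    destruct (Hx (eps / 2)) as [N HN]; [lra|].
    destruct (half_pow_small (eps / 2)) as [M HM]; [lra|].
    specialize (HN (N + M)%nat ltac:(lia)). specialize (Ha j (N + M)%nat).
    pose proof (half_pow_le M (N + M) ltac:(lia)).
    specialize (tri (a j) (a (N + M)%nat) x). lra.
Qed.

Context {Y : Type} (dY : Y -> Y -> R).

(** Basic neighbourhoods in the product of [Y], Baire space and the sequences in [X], with one
    number controlling all three factors. *)
Definition near (n : nat) (y : Y) (mu : nat -> nat) (s : nat -> X)
    (y' : Y) (mu' : nat -> nat) (s' : nat -> X) : Prop :=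
  dY y y' < (1/2) ^ n /\ agree n mu mu' /\ forall i, (i < n)%nat -> d (s i) (s' i) < (1/2) ^ n.

Lemma near_le (m n : nat) (y y' : Y) (mu mu' : nat -> nat) (s s' : nat -> X) :
  (m <= n)%nat -> near n y mu s y' mu' s' -> near m y mu s y' mu' s'.
Proof.
  intros Hmn [H1 [H2 H3]]. pose proof (half_pow_le m n Hmn).
  split; [lra|split].
  - intros i Hi. apply H2. lia.
  - intros i Hi. specialize (H3 i). assert (i < n)%nat by lia. specialize (H3 H0). lra.
Qed.

Definition product_closed (C : Y -> (nat -> nat) -> (nat -> X) -> Prop) : Prop :=
  forall y mu s, ~ C y mu s -> exists n, forall y' mu' s',
    near n y mu s y' mu' s' -> ~ C y' mu' s'.

Context (D : X -> Prop) (Hdense : dense d D).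
Context (e : nat -> K) (un : K -> nat) (Hun : forall n, un (e n) = n).
Context (pt : K -> X) (Hpt : forall x, D x -> exists k, pt k = x).

(* [alpha] codes a sequence of integers and, in fast Cauchy form, a sequence of
   points of [X]. *)
Lemma suslin_projection (C : Y -> (nat -> nat) -> (nat -> X) -> Prop) :
  product_closed C -> suslin K dY (fun y => exists mu s, C y mu s).
Proof.
  intros HC. destruct Hmet as [pos [zero [sym tri]]].
  (* Row 0 of [alpha] holds the integers, row [S i] the approximations to the point [s i]. *)
  set (dmu := fun (alpha : nat -> K) i => un (alpha (to_nat (0%nat, i)))).
  set (da := fun (alpha : nat -> K) i j => pt (alpha (to_nat (S i, j)))).
  exists (fun y alpha => exists s, (forall i j, d (da alpha i j) (s i) <= (1/2) ^ j) /\
                                   C y (dmu alpha) s).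
  split.
  - intros y alpha Hn.
    (* A violation of the fast Cauchy bound is already visible in two entries of [alpha]. Without
       one, completeness gives limits to which the closedness of [C] applies. *)
    destruct (classic (forall i j k,
      d (da alpha i j) (da alpha i k) <= (1/2) ^ j + (1/2) ^ k)) as [fast|nfast].
    + destruct (choice (fun i x => forall j, d (da alpha i j) x <= (1/2) ^ j)) as [s Hs].
      { intros i. apply fast_limit, fast. }
      destruct (HC y (dmu alpha) s) as [n Hnear]; [intros HCs; apply Hn; eauto|].
      (* Both codes share the approximation of index [S (S n)], so their limits differ by at most
         twice [(1/2) ^ S (S n)], less than [(1/2) ^ n]. *)
      destruct (bound_on_list (fun i => to_nat (0%nat, i) + to_nat (S i, S (S n)))%nat
                  (seq 0 n)) as [M HM].
      exists ((1/2) ^ n), M. split; [apply half_pow_pos|].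
      intros y' alpha' Hy Ha [s' [Hs' HC']].
      apply (Hnear y' (dmu alpha') s'); [|exact HC']. split; [exact Hy|split].
      * intros i Hi. unfold dmu. rewrite Ha; [reflexivity|].
        specialize (HM i ltac:(apply in_seq; lia)). cbv beta in HM. lia.
      * intros i Hi. specialize (Hs i (S (S n))). specialize (Hs' i (S (S n))).
        assert (E : da alpha' i (S (S n)) = da alpha i (S (S n))).
        { unfold da. rewrite Ha; [reflexivity|].
          specialize (HM i ltac:(apply in_seq; lia)). cbv beta in HM. lia. }
        rewrite E in Hs'. rewrite sym in Hs.
        specialize (tri (s i) (da alpha i (S (S n))) (s' i)).
        pose proof (half_pow_pos n). simpl in Hs, Hs'. lra.
    + apply not_all_ex_not in nfast. destruct nfast as [i nfast].
      apply not_all_ex_not in nfast. destruct nfast as [j nfast].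
      apply not_all_ex_not in nfast. destruct nfast as [k nfast].
      exists 1, (S (to_nat (S i, j) + to_nat (S i, k))). split; [lra|].
      intros y' alpha' _ Ha [s' [Hs' _]]. apply nfast.
      replace (da alpha i j) with (da alpha' i j) by (unfold da; rewrite Ha; [reflexivity|lia]).
      replace (da alpha i k) with (da alpha' i k) by (unfold da; rewrite Ha; [reflexivity|lia]).
      pose proof (Hs' i j) as H1. pose proof (Hs' i k) as H2. rewrite sym in H2.
      specialize (tri (da alpha' i j) (s' i) (da alpha' i k)). lra.
  - intros y. split.
    + intros [mu [s HCs]].
      destruct (choice (fun p k => forall i j, of_nat p = (S i, j) ->
        d (pt k) (s i) <= (1/2) ^ j)) as [h Hh].
      { intros p. destruct (of_nat p) as [[|i] j].
        - exists (e 0%nat). intros; discriminate.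
        - destruct (Hdense (s i) ((1/2) ^ j) (half_pow_pos j)) as [x [Dx Hx]].
          destruct (Hpt x Dx) as [k <-]. exists k. intros i' j' E. injection E as <- <-.
          rewrite sym. lra. }
      exists (fun p => match of_nat p with (0%nat, i) => e (mu i) | _ => h p end).
      exists s. split.
      * intros i j. unfold da. rewrite cancel_of_to. apply Hh. apply cancel_of_to.
      * replace (dmu _) with mu; [exact HCs|]. apply functional_extensionality. intros i.
        unfold dmu. rewrite cancel_of_to, Hun. reflexivity.
    + intros [alpha [s [_ HCs]]]. eauto.
Qed.

End Projection.

(** * Vanishing of formal sums of paths *)

Section Coloring.
Context {I : Type}.

Definition lsum (w : I -> Z) (J : list I) : Z := fold_right (fun i acc => (w i + acc)%Z) 0%Z J.

Lemma lsum_ext (w v : I -> Z) (J : list I) :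
  (forall i, In i J -> w i = v i) -> lsum w J = lsum v J.
Proof.
  induction J as [|i J IH]; intros H; [reflexivity|]. simpl.
  rewrite H by (left; reflexivity). rewrite IH; [reflexivity|]. intros; apply H; right; auto.
Qed.

Lemma lsum_add (w v : I -> Z) (J : list I) :
  lsum (fun i => w i + v i)%Z J = (lsum w J + lsum v J)%Z.
Proof. induction J as [|i J IH]; simpl; [reflexivity|]. rewrite IH. ring. Qed.

Lemma lsum_scale (z : Z) (w : I -> Z) (J : list I) :
  lsum (fun i => z * w i)%Z J = (z * lsum w J)%Z.
Proof. induction J as [|i J IH]; simpl; [ring|]. rewrite IH. ring. Qed.

Lemma lsum_zero (w : I -> Z) (J : list I) : (forall i, In i J -> w i = 0%Z) -> lsum w J = 0%Z.
Proof.
  intros H. rewrite (lsum_ext w (fun _ => 0%Z) J H). induction J as [|i J IH]; [reflexivity|].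
  simpl. apply IH. intros; apply H; right; auto.
Qed.

(** The factor [g (col i)] is constant on a colour class, so the sum is taken one colour at a
    time. *)
Lemma lsum_color (w : I -> Z) (col : I -> nat) (g : nat -> Z) (J : list I) :
  (forall c, lsum (fun i => if Nat.eqb (col i) c then w i else 0%Z) J = 0%Z) ->
  lsum (fun i => w i * g (col i))%Z J = 0%Z.
Proof.
  intros H. destruct (bound_on_list col J) as [M HM].
  assert (S : forall c, lsum (fun i => if Nat.ltb (col i) c then w i * g (col i) else 0)%Z J = 0%Z).
  { induction c as [|c IH].
    - apply lsum_zero. intros; destruct (col i); reflexivity.
    - rewrite (lsum_ext _ (fun i => (if Nat.ltb (col i) c then w i * g (col i) else 0) +
        g c * (if Nat.eqb (col i) c then w i else 0))%Z).
      + rewrite lsum_add, lsum_scale, H, IH. ring.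
      + intros i _. destruct (Nat.ltb_spec (col i) c), (Nat.ltb_spec (col i) (S c)),
          (Nat.eqb_spec (col i) c); try lia; subst; ring. }
  etransitivity; [|exact (S M)]. apply lsum_ext. intros i Hi. specialize (HM i Hi).
  destruct (Nat.ltb_spec (col i) M); [reflexivity|lia].
Qed.

(* A formal sum of paths vanishes iff the terms can be coloured so that terms of
   one colour are equal paths and the coefficients of each colour add up to 0;
   this turns equality of chains into a closed condition. *)
Lemma coloring_iff {X : Type} (w : I -> Z) (P : I -> R -> X) (J : list I) :
  (forall s, lsum (fun i => w i * ind (P i) s)%Z J = 0%Z) <->
  exists col : I -> nat,
    (forall c, lsum (fun i => if Nat.eqb (col i) c then w i else 0%Z) J = 0%Z) /\
    forall i j, In i J -> In j J -> col i = col j -> same1 (P i) (P j).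
Proof.
  split.
  - intros H.
    (* The colour of a term is the position in [J] of the first path equal to its own. *)
    set (pos := fix pos (J : list I) (i : I) := match J with
      | nil => 0%nat
      | j :: J' => if cdec (same1 (P j) (P i)) then 0%nat else S (pos J' i) end).
    assert (pos_eq : forall J i j, In i J -> In j J -> pos J i = pos J j ->
              same1 (P i) (P j)).
    { clear. induction J as [|k J IH]; intros i j; [intros []|]. simpl. unfold cdec.
      destruct (excluded_middle_informative (same1 (P k) (P i))) as [hi|hi];
      destruct (excluded_middle_informative (same1 (P k) (P j))) as [hj|hj]; try discriminate.
      - intros _ _ _. exact (same1_trans _ _ _ (same1_sym _ _ hi) hj).
      - intros [->|Hi] [->|Hj] E; try (exfalso; apply hi; intros ? ?; reflexivity);
          try (exfalso; apply hj; intros ? ?; reflexivity).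
        apply IH; auto. }
    assert (pos_same : forall J i j, same1 (P i) (P j) -> pos J i = pos J j).
    { clear. induction J as [|k J IH]; intros i j E; [reflexivity|]. simpl.
      rewrite (cdec_ext (same1 (P k) (P i)) (same1 (P k) (P j))), (IH i j E); [reflexivity|].
      split; intros H.
      - exact (same1_trans _ _ _ H E).
      - exact (same1_trans _ _ _ H (same1_sym _ _ E)). }
    exists (pos J). split; [|apply pos_eq]. intros c.
    destruct (classic (exists k, In k J /\ pos J k = c)) as [[k [Hk <-]]|no].
    + etransitivity; [|exact (H (P k))]. apply lsum_ext. intros i Hi. unfold ind, cdec.
      destruct (excluded_middle_informative (same1 (P i) (P k))) as [h|h];
        destruct (Nat.eqb_spec (pos J i) (pos J k)) as [E|E]; cbv iota; try lia.
      * exfalso. apply E, pos_same, h.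
      * exfalso. apply h, (pos_eq J); assumption.
    + apply lsum_zero. intros i Hi. destruct (Nat.eqb_spec (pos J i) c); [|reflexivity].
      exfalso. eauto.
  - intros [col [H1 H2]] s.
    (* Equal colours mean equal paths, so the indicator at [s] is a function of the colour and
       [lsum_color] applies. *)
    rewrite (lsum_ext _ (fun i => w i *
      (if cdec (exists j, In j J /\ col j = col i /\ same1 (P j) s) then 1 else 0))%Z).
    + apply (lsum_color w col (fun c =>
        if cdec (exists j, In j J /\ col j = c /\ same1 (P j) s) then 1 else 0)%Z J H1).
    + intros i Hi. unfold ind. f_equal.
      rewrite (cdec_ext (same1 (P i) s) (exists j, In j J /\ col j = col i /\ same1 (P j) s));
        [reflexivity|]. split; [eauto|]. intros [j [Hj [E Hs]]].
      exact (same1_trans _ _ _ (H2 i j Hi Hj (eq_sym E)) Hs).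
Qed.

End Coloring.

(** * Singular triangles and their values at rational points *)

Section Simplices.
Context {X : Type} (d : X -> X -> R) (Hmet : is_metric d).

Definition dist1 (p q : R * R) : R := Rabs (fst p - fst q) + Rabs (snd p - snd q).

Definition in_triangle (p : R * R) : Prop := in_D2 (fst p) (snd p).

Lemma dist1_sym (p q : R * R) : dist1 p q = dist1 q p.
Proof. unfold dist1. rewrite Rabs_minus_sym, (Rabs_minus_sym (snd p)). reflexivity. Qed.

Lemma dist1_tri (p q r : R * R) : dist1 p r <= dist1 p q + dist1 q r.
Proof.
  unfold dist1.
  replace (fst p - fst r) with ((fst p - fst q) + (fst q - fst r)) by ring.
  replace (snd p - snd r) with ((snd p - snd q) + (snd q - snd r)) by ring.
  pose proof (Rabs_triang (fst p - fst q) (fst q - fst r)).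
  pose proof (Rabs_triang (snd p - snd q) (snd q - snd r)). lra.
Qed.

Lemma cont2_uniform (f : R -> R -> X) (eps : R) : cont2 d f -> 0 < eps ->
  exists n, forall a b a' b', in_D2 a b -> in_D2 a' b' ->
    dist1 (a, b) (a', b') < (1/2) ^ n -> d (f a b) (f a' b') < eps.
Proof.
  intros Hf Heps. destruct Hmet as [pos [zero [sym tri]]].
  (* The compactness lemma covers a square, so points beyond the hypotenuse need a gauge too; there
     the box around the point misses the triangle. The factor 4 leaves room for [2 * rho] to the
     first point and less than [rho] from it to the second. *)
  destruct (choice (fun (p : R * R) (rho : posreal) =>
    (in_triangle p -> forall a b, in_D2 a b -> dist1 p (a, b) < 4 * rho ->
      d (f (fst p) (snd p)) (f a b) < eps / 2) /\
    (~ in_triangle p -> 0 <= fst p -> 0 <= snd p -> 2 * rho <= fst p + snd p - 1)))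
    as [rho Hrho].
  - intros [u v]. unfold in_triangle. simpl.
    destruct (classic (in_D2 u v)) as [H|H].
    + destruct (Hf u v H (eps / 2)) as [delta [Hd Hdelta]]; [lra|].
      assert (Hp : 0 < delta / 4) by lra. exists (mkposreal _ Hp). simpl.
      split; [|tauto]. intros _ a b Hab Hdist. apply Hdelta; [exact Hab|].
      unfold dist1 in Hdist. simpl in Hdist. lra.
    + destruct (Rlt_le_dec 1 (u + v)) as [L|L].
      * assert (Hp : 0 < (u + v - 1) / 2) by lra. exists (mkposreal _ Hp). simpl.
        split; [tauto|]. intros. lra.
      * exists (mkposreal 1 Rlt_0_1). split; [tauto|]. intros. exfalso. apply H.
        unfold in_D2. tauto.
  - destruct (Compactness.compactness_value_2d 0 1 0 1 (fun u v => rho (u, v))) as [r Hr].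
    destruct (half_pow_small r (cond_pos r)) as [n Hn]. exists n.
    intros a b a' b' Hab Hab' Hdist. unfold in_D2 in *.
    specialize (Hr a b ltac:(lra) ltac:(lra)). apply NNPP in Hr.
    destruct Hr as [u [v [Hu [Hv [Hau [Hbv Hle]]]]]].
    destruct (Hrho (u, v)) as [H1 H2]. unfold in_triangle in *. cbv beta in *; cbn [fst snd] in *.
    destruct (classic (in_D2 u v)) as [Huv|Huv].
    + specialize (H1 Huv). pose proof (H1 a b Hab) as A. pose proof (H1 a' b' Hab') as B.
      pose proof (dist1_tri (u, v) (a, b) (a', b')) as T.
      assert (E : dist1 (u, v) (a, b) < 2 * rho (u, v)).
      { rewrite dist1_sym. unfold dist1. simpl. lra. }
      pose proof (cond_pos (rho (u, v))). specialize (A ltac:(lra)). specialize (B ltac:(lra)). rewrite sym in A.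
      specialize (tri (f a b) (f u v) (f a' b')). lra.
    + exfalso. specialize (H2 Huv ltac:(lra) ltac:(lra)).
      unfold Rabs in Hau, Hbv. destruct Rcase_abs in Hau; destruct Rcase_abs in Hbv; lra.
Qed.

(** Enumerates the pairs of nonnegative fractions with a common denominator. Many lie outside the
    triangle, hence the recurring [in_triangle (grid p)]. *)
Definition grid (p : nat) : R * R :=
  let '(i, q) := of_nat p in let '(j, k) := of_nat q in
  (INR i * / INR (S k), INR j * / INR (S k)).

Lemma grid_surj (i j k : nat) : exists p, grid p = (INR i * / INR (S k), INR j * / INR (S k)).
Proof.
  exists (to_nat (i, to_nat (j, k))). unfold grid. rewrite cancel_of_to.
  rewrite cancel_of_to. reflexivity.
Qed.

Lemma floor_frac (t : R) (k : nat) : 0 <= t -> exists i,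
  INR i * / INR (S k) <= t /\ t - INR i * / INR (S k) < / INR (S k).
Proof.
  intros Ht. assert (Hk : 0 < INR (S k)) by (apply lt_0_INR; lia).
  assert (Hinv : 0 < / INR (S k)) by (apply Rinv_0_lt_compat, Hk).
  assert (E : INR (S k) * / INR (S k) = 1) by (field; lra).
  destruct (Rcomplements.nfloor_ex (t * INR (S k))) as [i [H1 H2]]; [nra|].
  exists i. split; nra.
Qed.

Lemma grid_dense (q : R * R) (delta : R) : in_triangle q -> 0 < delta ->
  exists p, in_triangle (grid p) /\ dist1 (grid p) q < delta.
Proof.
  destruct q as [a b]. unfold in_triangle, in_D2. simpl. intros [Ha [Hb Hab]] Hd.
  destruct (archimed_cor1 (delta / 2)) as [N [HN HN0]]; [lra|].
  destruct N as [|k]; [lia|].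
  destruct (floor_frac a k Ha) as [i [I1 I2]]. destruct (floor_frac b k Hb) as [j [J1 J2]].
  destruct (grid_surj i j k) as [p Hp]. exists p. rewrite Hp. unfold dist1. cbn [fst snd].
  assert (Hinv : 0 < / INR (S k)) by (apply Rinv_0_lt_compat, lt_0_INR; lia).
  pose proof (pos_INR i). pose proof (pos_INR j).
  split; [split; [nra|split; [nra|lra]]|].
  unfold Rabs. repeat destruct Rcase_abs; lra.
Qed.

(** The cap by [Nat.min] puts every value into [0,1], so no side condition is carried along. *)
Definition tick (r : nat) : R :=
  let '(i, k) := of_nat r in INR (Nat.min i (S k)) * / INR (S k).

Lemma tick_frac (r : nat) : exists i k, (i <= S k)%nat /\ tick r = INR i * / INR (S k).
Proof.
  unfold tick. destruct (of_nat r) as [i k]. exists (Nat.min i (S k)), k.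
  split; [lia|reflexivity].
Qed.

Lemma tick_in (r : nat) : in_D1 (tick r).
Proof.
  destruct (tick_frac r) as [i [k [Hi ->]]]. apply le_INR in Hi. pose proof (pos_INR i).
  assert (Hk : 0 < INR (S k)) by (apply lt_0_INR; lia).
  assert (Hinv : 0 < / INR (S k)) by (apply Rinv_0_lt_compat, Hk).
  assert (E : INR (S k) * / INR (S k) = 1) by (field; lra).
  unfold in_D1. nra.
Qed.

Lemma tick_dense (t delta : R) : in_D1 t -> 0 < delta -> exists r, Rabs (t - tick r) < delta.
Proof.
  intros [Ht0 Ht1] Hd. destruct (archimed_cor1 delta Hd) as [N [HN HN0]].
  destruct N as [|k]; [lia|]. destruct (floor_frac t k Ht0) as [i [I1 I2]].
  assert (Hk : 0 < INR (S k)) by (apply lt_0_INR; lia).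
  assert (E : INR (S k) * / INR (S k) = 1) by (field; lra).
  assert (Hi : (i <= S k)%nat) by (apply INR_le; nra).
  exists (to_nat (i, k)). unfold tick. rewrite cancel_of_to, Nat.min_l by exact Hi.
  rewrite Rabs_pos_eq; lra.
Qed.

Lemma same1_of_ticks (g h : R -> X) :
  cont1 d g -> cont1 d h -> (forall r, g (tick r) = h (tick r)) -> same1 g h.
Proof.
  intros Hg Hh E t Ht. destruct Hmet as [pos [zero [sym tri]]]. apply zero.
  apply Rle_antisym; [|apply pos]. apply Rle_of_small. intros eps Heps.
  destruct (Hg t Ht (eps / 2)) as [d1 [D1 H1]]; [lra|].
  destruct (Hh t Ht (eps / 2)) as [d2 [D2 H2]]; [lra|].
  destruct (tick_dense t (Rmin d1 d2) Ht) as [r Hr]; [apply Rmin_glb_lt; assumption|].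
  pose proof (Rmin_l d1 d2). pose proof (Rmin_r d1 d2).
  specialize (H1 (tick r) (tick_in r) ltac:(lra)).
  specialize (H2 (tick r) (tick_in r) ltac:(lra)).
  rewrite E in H1. rewrite sym in H2. specialize (tri (g t) (h (tick r)) (h t)). lra.
Qed.

Definition face_point (f : nat) (t : R) : R * R :=
  match f with 0%nat => (1 - t, t) | 1%nat => (0, t) | _ => (t, 0) end.

Definition face (f : nat) (sigma : R -> R -> X) : R -> X :=
  fun t => sigma (fst (face_point f t)) (snd (face_point f t)).

Lemma face_point_in (f : nat) (t : R) : in_D1 t -> in_triangle (face_point f t).
Proof.
  unfold in_D1, in_triangle, in_D2. destruct f as [|[|f]]; simpl; lra.
Qed.

Lemma cont1_face (f : nat) (sigma : R -> R -> X) : cont2 d sigma -> cont1 d (face f sigma).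
Proof.
  intros H t Ht eps Heps.
  destruct (H _ _ (face_point_in f t Ht) eps Heps) as [delta [Hd Hs]].
  exists (delta / 2). split; [lra|]. intros t' Ht' Hdist.
  apply (Hs _ _ (face_point_in f t' Ht')).
  assert (Z : Rabs (0 - 0) = 0) by (rewrite Rminus_0_r; apply Rabs_R0).
  assert (F : Rabs (1 - t - (1 - t')) = Rabs (t - t')).
  { rewrite Rabs_minus_sym. f_equal. ring. }
  destruct f as [|[|f]]; simpl; try rewrite Z; try rewrite F; lra.
Qed.

(** Rational points of the faces are grid points, so the values of a face at the ticks can be read
    off the code of its triangle. *)
Lemma grid_face_exists : exists pf : nat -> nat -> nat,
  forall f r, grid (pf f r) = face_point f (tick r).
Proof.
  destruct (choice (fun (q : nat * nat) p => grid p = face_point (fst q) (tick (snd q))))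
    as [pf Hpf].
  - intros [f r]. simpl. destruct (tick_frac r) as [i [k [Hi ->]]].
    assert (Hk : INR (S k) <> 0) by (apply not_0_INR; lia).
    destruct f as [|[|f]]; cbn [face_point].
    + destruct (grid_surj (S k - i) i k) as [p Hp]. exists p. rewrite Hp.
      rewrite minus_INR by exact Hi. f_equal. field. exact Hk.
    + destruct (grid_surj 0 i k) as [p Hp]. exists p. rewrite Hp. f_equal.
      simpl (INR 0). ring.
    + destruct (grid_surj i 0 k) as [p Hp]. exists p. rewrite Hp. f_equal.
      simpl (INR 0). ring.
  - exists (fun f r => pf (f, r)). intros f r. apply (Hpf (f, r)).
Qed.

Definition grid_face : nat -> nat -> nat :=
  proj1_sig (constructive_indefinite_description _ grid_face_exists).

Lemma grid_face_spec (f r : nat) : grid (grid_face f r) = face_point f (tick r).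
Proof. exact (proj2_sig (constructive_indefinite_description _ grid_face_exists) f r). Qed.

Context (Hcomp : complete d).

(** Extension of a uniformly continuous map from a dense set into a complete space, with [md] as the
    modulus. *)
Lemma extend_from_grid (v : nat -> X) (md : nat -> nat) :
  (forall k p q, in_triangle (grid p) -> in_triangle (grid q) ->
     dist1 (grid p) (grid q) < (1/2) ^ md k -> d (v p) (v q) <= (1/2) ^ k) ->
  exists sigma, cont2 d sigma /\ forall p, in_triangle (grid p) ->
    sigma (fst (grid p)) (snd (grid p)) = v p.
Proof.
  intros Hv. destruct Hmet as [pos [zero [sym tri]]].
  (* With the exponent [S (md k)], two grid points this close to [q] are within [(1/2) ^ md k] of
     each other. *)
  destruct (choice_on (v 0%nat) in_triangle (fun q x => forall k p, in_triangle (grid p) ->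
    dist1 (grid p) q < (1/2) ^ S (md k) -> d (v p) x <= (1/2) ^ k)) as [sg Hsg].
  - intros q Hq.
    destruct (choice (fun j p => in_triangle (grid p) /\
      forall k, (k <= j)%nat -> dist1 (grid p) q < (1/2) ^ S (md k))) as [a Ha].
    { intros j. destruct (bound_on_list md (seq 0 (S j))) as [M HM].
      destruct (grid_dense q ((1/2) ^ M) Hq (half_pow_pos M)) as [p [Hp1 Hp2]].
      exists p. split; [exact Hp1|]. intros k Hk.
      specialize (HM k ltac:(apply in_seq; lia)).
      pose proof (half_pow_le (S (md k)) M HM). lra. }
    assert (near2 : forall k p p', in_triangle (grid p) -> in_triangle (grid p') ->
      dist1 (grid p) q < (1/2) ^ S (md k) -> dist1 (grid p') q < (1/2) ^ S (md k) ->
      d (v p) (v p') <= (1/2) ^ k).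
    { intros k p p' Hp Hp' H H'. apply Hv; [exact Hp|exact Hp'|].
      rewrite dist1_sym in H'. pose proof (dist1_tri (grid p) q (grid p')).
      simpl in H, H'. lra. }
    destruct (fast_limit d Hmet Hcomp (fun j => v (a j))) as [x Hx].
    { intros j k. pose proof (half_pow_pos j). pose proof (half_pow_pos k).
      destruct (Nat.le_ge_cases j k) as [L|L].
      - assert (d (v (a j)) (v (a k)) <= (1/2) ^ j); [|lra].
        apply near2; [apply Ha|apply Ha|apply (proj2 (Ha j)); lia|apply (proj2 (Ha k)); lia].
      - assert (d (v (a j)) (v (a k)) <= (1/2) ^ k); [|lra].
        apply near2; [apply Ha|apply Ha|apply (proj2 (Ha j)); lia|apply (proj2 (Ha k)); lia]. }
    exists x. intros k p Hp Hd. apply Rle_of_small. intros eps Heps.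
    destruct (half_pow_small eps Heps) as [n Hn].
    pose proof (near2 k p (a (k + n)%nat) Hp (proj1 (Ha _)) Hd
                  (proj2 (Ha (k + n)%nat) k ltac:(lia))) as A.
    pose proof (Hx (k + n)%nat) as B. cbv beta in B.
    pose proof (half_pow_le n (k + n) ltac:(lia)).
    specialize (tri (v p) (v (a (k + n)%nat)) x). lra.
  - exists (fun a b => sg (a, b)). split.
    + intros a b Hab eps Heps. destruct (half_pow_small (eps / 2)) as [k Hk]; [lra|].
      pose proof (half_pow_pos (S (S (md k)))) as Hw.
      (* One more halving lets a single grid point [p] serve both (a, b) and (a', b'). *)
      exists ((1/2) ^ S (S (md k))). split; [exact Hw|]. intros a' b' Hab' Hd.
      destruct (grid_dense (a, b) ((1/2) ^ S (S (md k))) Hab Hw) as [p [Hp1 Hp2]].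
      pose proof (Hsg (a, b) Hab k p Hp1) as A. pose proof (Hsg (a', b') Hab' k p Hp1) as B.
      pose proof (dist1_tri (grid p) (a, b) (a', b')) as T.
      unfold dist1 in T at 3. cbn [fst snd] in T.
      change ((1/2) ^ S (S (md k))) with (1/2 * (1/2) ^ S (md k)) in *.
      specialize (A ltac:(lra)). specialize (B ltac:(lra)). rewrite sym in A.
      specialize (tri (sg (a, b)) (v p) (sg (a', b'))). lra.
    + intros p Hp. rewrite <- surjective_pairing. symmetry. apply zero.
      apply Rle_antisym; [|apply pos]. apply Rle_of_small. intros eps Heps.
      destruct (half_pow_small eps Heps) as [k Hk].
      pose proof (Hsg (grid p) Hp k p Hp) as A.
      assert (Z : dist1 (grid p) (grid p) = 0).
      { unfold dist1. rewrite !Rminus_diag, Rabs_R0. ring. }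
      pose proof (half_pow_pos (S (md k))). specialize (A ltac:(lra)). lra.
Qed.

End Simplices.

(** * Homology of the wedge loops is Suslin *)

Lemma Z_of_nat_onto : exists g : nat -> Z, forall z, exists n, g n = z.
Proof.
  destruct emb_Z_nat as [f Hf]. destruct (left_inverse 0%Z f Hf) as [g Hg].
  exists g. intros z. exists (f z). apply Hg.
Qed.

Definition zdec : nat -> Z :=
  proj1_sig (constructive_indefinite_description _ Z_of_nat_onto).

Lemma zdec_onto (z : Z) : exists n, zdec n = z.
Proof. exact (proj2_sig (constructive_indefinite_description _ Z_of_nat_onto) z). Qed.

Section SuslinHomology.
Context {X : Type} (d : X -> X -> R) (Hmet : is_metric d) (Hcomp : complete d).
Context (L : (nat -> bool) -> R -> X) (HLc : forall b, cont1 d (L b))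
  (HLloc : forall t, exists n, forall b b', b n = b' n -> L b t = L b' t).

(* The terms of the chain [L (fst y) - L (snd y) - bd2 m]: [(0, 0)] and [(0, 1)]
   stand for the two paths, [(S i, f)] for the face [f] of the [i]-th triangle. *)
Definition term : Type := (nat * nat)%type.

Definition triangle_terms (l : list nat) : list term :=
  flat_map (fun i => (S i, 0%nat) :: (S i, 1%nat) :: (S i, 2%nat) :: nil) l.

Definition terms (N : nat) : list term :=
  (0%nat, 0%nat) :: (0%nat, 1%nat) :: triangle_terms (seq 0 N).

(** [bd2 m] is subtracted, so the alternating signs of the faces are reversed and the middle face
    counts positively. *)
Definition weight (z : nat -> Z) (i : term) : Z :=
  match i with
  | (0%nat, 0%nat) => 1
  | (0%nat, _) => -1
  | (S i, 1%nat) => z i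
  | (S i, _) => - z i
  end%Z.

Definition term_path (y : nat -> bool * bool) (sg : nat -> R -> R -> X) (i : term) : R -> X :=
  match i with
  | (0%nat, 0%nat) => L (fun n => fst (y n))
  | (0%nat, _) => L (fun n => snd (y n))
  | (S i, f) => face f (sg i)
  end.

Definition term_value (y : nat -> bool * bool) (s : nat -> X) (i : term) (r : nat) : X :=
  match i with
  | (0%nat, 0%nat) => L (fun n => fst (y n)) (tick r)
  | (0%nat, _) => L (fun n => snd (y n)) (tick r)
  | (S i, f) => s (to_nat (i, grid_face f r))
  end.

Definition endpoints_homologous (y : nat -> bool * bool) : Prop :=
  homologous d ((1%Z, L (fun n => fst (y n))) :: nil) ((1%Z, L (fun n => snd (y n))) :: nil).

Lemma terms_coeff (y : nat -> bool * bool) (sg : nat -> R -> R -> X) (z : nat -> Z)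
    (N : nat) (s : R -> X) :
  lsum (fun i => weight z i * ind (term_path y sg i) s)%Z (terms N) =
  (ind (L (fun n => fst (y n))) s - ind (L (fun n => snd (y n))) s -
   coeff1 (bd2 (map (fun i => (z i, sg i)) (seq 0 N))) s)%Z.
Proof.
  assert (H : forall l, lsum (fun i => weight z i * ind (term_path y sg i) s)%Z
    (triangle_terms l) = (- coeff1 (bd2 (map (fun i => (z i, sg i)) l)) s)%Z).
  { induction l as [|i l IH]; [reflexivity|].
    change (triangle_terms (i :: l)) with
      ((S i, 0%nat) :: (S i, 1%nat) :: (S i, 2%nat) :: triangle_terms l).
    change (map (fun i => (z i, sg i)) (i :: l)) with
      ((z i, sg i) :: map (fun i => (z i, sg i)) l).
    rewrite coeff1_bd2_cons. cbn [lsum fold_right].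
    fold (lsum (fun i => weight z i * ind (term_path y sg i) s)%Z (triangle_terms l)).
    rewrite IH. cbn [weight term_path].
    change (face 0 (sg i)) with (face0 (sg i)). change (face 1 (sg i)) with (face1 (sg i)).
    change (face 2 (sg i)) with (face2 (sg i)). ring. }
  unfold terms. cbn [lsum fold_right].
  fold (lsum (fun i => weight z i * ind (term_path y sg i) s)%Z (triangle_terms (seq 0 N))).
  rewrite H. cbn [weight term_path]. ring.
Qed.

Lemma list_as_seq {A : Type} (a0 : A) (m : list A) :
  m = map (fun i => nth i m a0) (seq 0 (length m)).
Proof.
  induction m as [|a m IH]; [reflexivity|]. simpl. f_equal.
  rewrite <- seq_shift, map_map. exact IH.
Qed.

Lemma homologous_terms (y : nat -> bool * bool) : endpoints_homologous y <->
  exists N z sg, (forall i, cont2 d (sg i)) /\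
    forall s, lsum (fun i => weight z i * ind (term_path y sg i) s)%Z (terms N) = 0%Z.
Proof.
  split.
  - intros [m [Hm E]].
    (* Past the end of [m] the family is padded with a constant triangle, so that every [sg i] is
       continuous. *)
    set (q0 := (0%Z, fun _ _ : R => L (fun _ => true) 0)).
    exists (length m), (fun i => fst (nth i m q0)), (fun i => snd (nth i m q0)). split.
    + intros i. destruct (Nat.lt_ge_cases i (length m)) as [Hi|Hi].
      * apply (proj1 (Forall_forall _ m) Hm). apply nth_In, Hi.
      * rewrite nth_overflow by exact Hi. intros a b _ eps Heps. exists 1.
        split; [lra|]. intros a' b' _ _. destruct Hmet as [_ [H _]]. simpl.
        rewrite (proj2 (H _ _) eq_refl). exact Heps.
    + intros s. rewrite terms_coeff.
      replace (map _ (seq 0 (length m))) with m.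
      * rewrite <- E, !coeff1_cons. unfold coeff1; simpl fold_right. ring.
      * rewrite (list_as_seq q0 m) at 1. apply map_ext. intros i. apply surjective_pairing.
  - intros [N [z [sg [Hsg H]]]]. exists (map (fun i => (z i, sg i)) (seq 0 N)). split.
    + apply Forall_map, Forall_forall. intros i _. apply Hsg.
    + intros s. specialize (H s). rewrite terms_coeff in H. rewrite !coeff1_cons.
      unfold coeff1 at 1 2; simpl fold_right. lia.
Qed.

Definition slot (mu : nat -> nat) (i j : nat) : nat := mu (to_nat (i, j)).

Definition code_size (mu : nat -> nat) : nat := slot mu 0 0.
Definition code_coeff (mu : nat -> nat) (i : nat) : Z := zdec (slot mu 1 i).
Definition code_color (mu : nat -> nat) (i : term) : nat := slot mu 2 (to_nat i).
Definition code_modulus (mu : nat -> nat) (i k : nat) : nat := slot mu (3 + i) k.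

Definition color_sum (mu : nat -> nat) (c : nat) : Z :=
  lsum (fun i => if Nat.eqb (code_color mu i) c then weight (code_coeff mu) i else 0%Z)
    (terms (code_size mu)).

(** The first and third clauses come from [coloring_iff], with paths compared at the ticks; the
    second is the hypothesis of [extend_from_grid], with a non-strict inequality to keep it
    closed. *)
Definition boundary_code (y : nat -> bool * bool) (mu : nat -> nat) (s : nat -> X) : Prop :=
  (forall c, color_sum mu c = 0%Z) /\
  (forall i k p q, in_triangle (grid p) -> in_triangle (grid q) ->
     dist1 (grid p) (grid q) < (1/2) ^ code_modulus mu i k ->
     d (s (to_nat (i, p))) (s (to_nat (i, q))) <= (1/2) ^ k) /\
  (forall i j, In i (terms (code_size mu)) -> In j (terms (code_size mu)) ->
     code_color mu i = code_color mu j ->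
     forall r, term_value y s i r = term_value y s j r).

Lemma cont1_term_path (y : nat -> bool * bool) (sg : nat -> R -> R -> X) (i : term) :
  (forall i, cont2 d (sg i)) -> cont1 d (term_path y sg i).
Proof.
  intros H. destruct i as [[|i] f]; [destruct f; apply HLc|]. apply cont1_face, H.
Qed.

Lemma term_value_path (y : nat -> bool * bool) (sg : nat -> R -> R -> X) (s : nat -> X)
    (i : term) (r : nat) :
  (forall i p, in_triangle (grid p) ->
     sg i (fst (grid p)) (snd (grid p)) = s (to_nat (i, p))) ->
  term_path y sg i (tick r) = term_value y s i r.
Proof.
  intros H. destruct i as [[|i] f]; [destruct f; reflexivity|].
  cbn [term_path term_value]. rewrite <- H; rewrite grid_face_spec; [reflexivity|].
  apply face_point_in, tick_in.
Qed.

Lemma homologous_code (y : nat -> bool * bool) :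
  endpoints_homologous y <-> exists mu s, boundary_code y mu s.
Proof.
  rewrite homologous_terms. split.
  - intros [N [z [sg [Hsg H]]]]. apply coloring_iff in H. destruct H as [col [H1 H2]].
    destruct (choice (fun i n => zdec n = z i)) as [zc Hzc]; [intros; apply zdec_onto|].
    destruct (choice (fun (q : nat * nat) n => forall a b a' b', in_D2 a b -> in_D2 a' b' ->
      dist1 (a, b) (a', b') < (1/2) ^ n ->
      d (sg (fst q) a b) (sg (fst q) a' b') < (1/2) ^ (snd q))) as [md Hmd].
    { intros [i k]. apply cont2_uniform; [exact Hmet|apply Hsg|apply half_pow_pos]. }
    set (mu := fun n => let '(i, j) := of_nat n in match i with
      | 0%nat => N | 1%nat => zc j | 2%nat => col (of_nat j)
      | S (S (S i)) => md (i, j) end).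
    set (s := fun n => let '(i, p) := of_nat n in sg i (fst (grid p)) (snd (grid p))).
    assert (Hs : forall i p, s (to_nat (i, p)) = sg i (fst (grid p)) (snd (grid p))).
    { intros i p. unfold s. rewrite cancel_of_to. reflexivity. }
    assert (E0 : code_size mu = N).
    { unfold code_size, slot, mu. rewrite cancel_of_to. reflexivity. }
    assert (E1 : code_coeff mu = z).
    { apply functional_extensionality. intros i. unfold code_coeff, slot, mu.
      rewrite cancel_of_to. apply Hzc. }
    assert (E2 : forall i, code_color mu i = col i).
    { intros i. unfold code_color, slot, mu. rewrite !cancel_of_to. reflexivity. }
    assert (E3 : forall i k, code_modulus mu i k = md (i, k)).
    { intros i k. unfold code_modulus, slot, mu. rewrite cancel_of_to. reflexivity. }
    exists mu, s. split; [|split].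
    + intros c. unfold color_sum. rewrite E0, E1. etransitivity; [|exact (H1 c)]. apply lsum_ext.
      intros i _. rewrite E2. reflexivity.
    + intros i k p q Hp Hq Hd. rewrite E3 in Hd. rewrite !Hs. left.
      apply (Hmd (i, k)); [exact Hp|exact Hq|]. rewrite <- !surjective_pairing. exact Hd.
    + rewrite E0. intros i j Hi Hj E r. rewrite !E2 in E.
      rewrite <- !(term_value_path y sg s) by (intros; symmetry; apply Hs).
      apply (H2 i j Hi Hj E), tick_in.
  - intros [mu [s [H1 [H2 H3]]]].
    destruct (choice (fun i f => cont2 d f /\ forall p, in_triangle (grid p) ->
      f (fst (grid p)) (snd (grid p)) = s (to_nat (i, p)))) as [sg Hsg].
    { intros i. apply (extend_from_grid d Hmet Hcomp (fun p => s (to_nat (i, p)))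
        (code_modulus mu i)). intros k p q. apply H2. }
    exists (code_size mu), (code_coeff mu), sg. split; [intros; apply Hsg|].
    apply coloring_iff. exists (code_color mu). split; [exact H1|].
    intros i j Hi Hj E. apply (same1_of_ticks d Hmet).
    + apply cont1_term_path. intros; apply Hsg.
    + apply cont1_term_path. intros; apply Hsg.
    + intros r. rewrite !(term_value_path y sg s) by (intros; apply Hsg; assumption).
      apply H3; assumption.
Qed.

Lemma term_value_near (y : nat -> bool * bool) (s : nat -> X) (i : term) (r : nat) (eps : R) :
  0 < eps -> exists n, forall mu y' mu' s', near d seq_dist n y mu s y' mu' s' ->
    d (term_value y s i r) (term_value y' s' i r) < eps.
Proof.
  intros Heps.
  assert (path : forall f : bool * bool -> bool, exists n, forall y', seq_dist y y' < (1/2) ^ n ->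
    d (L (fun k => f (y k)) (tick r)) (L (fun k => f (y' k)) (tick r)) < eps).
  { intros f. destruct (HLloc (tick r)) as [n Hn]. exists n. intros y' Hy.
    rewrite (Hn (fun k => f (y k)) (fun k => f (y' k))).
    - destruct Hmet as [_ [H _]]. rewrite (proj2 (H _ _) eq_refl). exact Heps.
    - f_equal. apply (seq_dist_lt y y' n Hy). lia. }
  destruct i as [[|i] f].
  - destruct f as [|f].
    + destruct (path fst) as [n Hn]. exists n. intros mu y' mu' s' [Hy _]. apply Hn, Hy.
    + destruct (path snd) as [n Hn]. exists n. intros mu y' mu' s' [Hy _]. apply Hn, Hy.
  - destruct (half_pow_small eps Heps) as [n Hn]. cbn [term_value].
    set (p := to_nat (i, grid_face f r)). exists (S (n + p)). intros mu y' mu' s' [_ [_ Hs]].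
    specialize (Hs p ltac:(lia)). pose proof (half_pow_le n (S (n + p)) ltac:(lia)). lra.
Qed.

(** Only the size and the colours and coefficients of the listed terms enter, so finitely many
    entries of [mu] decide the sums of all colours. Triangle [i] appears in a term as [S i], hence
    the [pred]. *)
Lemma code_agree (mu : nat -> nat) : exists n, forall mu', agree n mu mu' ->
  code_size mu' = code_size mu /\
  (forall i, In i (terms (code_size mu)) -> code_color mu' i = code_color mu i) /\
  forall c, color_sum mu' c = color_sum mu c.
Proof.
  destruct (bound_on_list (fun i : term =>
    (to_nat (2, to_nat i) + to_nat (1, pred (fst i)))%nat) (terms (code_size mu))) as [M HM].
  exists (S (M + to_nat (0, 0)))%nat. intros mu' Ha.
  assert (E0 : code_size mu' = code_size mu) by (symmetry; apply Ha; lia).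
  assert (E2 : forall i, In i (terms (code_size mu)) -> code_color mu' i = code_color mu i).
  { intros i Hi. specialize (HM i Hi). symmetry. apply Ha. cbv beta in HM. lia. }
  split; [exact E0|split; [exact E2|]]. intros c. unfold color_sum. rewrite E0.
  apply lsum_ext. intros i Hi. rewrite E2 by exact Hi.
  destruct (Nat.eqb (code_color mu i) c); [|reflexivity].
  destruct i as [[|i] f]; [reflexivity|].
  assert (E : code_coeff mu' i = code_coeff mu i).
  { unfold code_coeff, slot. rewrite Ha; [reflexivity|]. specialize (HM _ Hi).
    simpl pred in HM. cbv beta in HM. lia. }
  cbn [weight]. rewrite E. reflexivity.
Qed.

Lemma boundary_code_closed : product_closed d seq_dist boundary_code.
Proof.
  destruct Hmet as [pos [zero [sym tri]]].
  intros y mu s Hn. destruct (code_agree mu) as [n0 Hn0].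
  apply not_and_or in Hn. destruct Hn as [Hn|Hn]; [|apply not_and_or in Hn; destruct Hn as [Hn|Hn]].
  - apply not_all_ex_not in Hn. destruct Hn as [c Hc]. exists n0.
    intros y' mu' s' [_ [Ha _]] [H _]. apply Hc. rewrite <- (H c). symmetry.
    apply (Hn0 mu' Ha).
  - apply not_all_ex_not in Hn. destruct Hn as [i Hn].
    apply not_all_ex_not in Hn. destruct Hn as [k Hn].
    apply not_all_ex_not in Hn. destruct Hn as [p Hn].
    apply not_all_ex_not in Hn. destruct Hn as [q Hn].
    apply imply_to_and in Hn. destruct Hn as [Hp Hn].
    apply imply_to_and in Hn. destruct Hn as [Hq Hn].
    apply imply_to_and in Hn. destruct Hn as [Hd Hn]. apply Rnot_le_lt in Hn.
    set (ip := to_nat (i, p)) in *. set (iq := to_nat (i, q)) in *.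
    destruct (half_pow_small ((d (s ip) (s iq) - (1/2) ^ k) / 2)) as [n1 Hn1]; [lra|].
    set (n := S (n1 + ip + iq + to_nat ((3 + i)%nat, k))%nat). exists n.
    intros y' mu' s' [_ [Ha Hs]] [_ [H _]].
    assert (E : code_modulus mu' i k = code_modulus mu i k).
    { symmetry. apply Ha. unfold n. lia. }
    specialize (H i k p q Hp Hq). rewrite E in H. specialize (H Hd). fold ip iq in H.
    pose proof (Hs ip ltac:(unfold n; lia)) as A. pose proof (Hs iq ltac:(unfold n; lia)) as B.
    rewrite sym in B. pose proof (half_pow_le n1 n ltac:(unfold n; lia)).
    pose proof (tri (s ip) (s' ip) (s iq)). pose proof (tri (s' ip) (s' iq) (s iq)). lra.
  - apply not_all_ex_not in Hn. destruct Hn as [i Hn].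
    apply not_all_ex_not in Hn. destruct Hn as [j Hn].
    apply imply_to_and in Hn. destruct Hn as [Hi Hn].
    apply imply_to_and in Hn. destruct Hn as [Hj Hn].
    apply imply_to_and in Hn. destruct Hn as [Hc Hn].
    apply not_all_ex_not in Hn. destruct Hn as [r Hn].
    set (eta := d (term_value y s i r) (term_value y s j r)).
    assert (Heta : 0 < eta).
    { destruct (pos (term_value y s i r) (term_value y s j r)) as [H|H]; [exact H|].
      exfalso. apply Hn, zero. symmetry. exact H. }
    destruct (term_value_near y s i r (eta / 2)) as [n1 Hn1]; [lra|].
    destruct (term_value_near y s j r (eta / 2)) as [n2 Hn2]; [lra|].
    exists (n0 + n1 + n2)%nat. intros y' mu' s' Hnear [_ [_ H]].
    assert (Ha : agree n0 mu mu') by (intros u Hu; apply Hnear; lia).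
    destruct (Hn0 mu' Ha) as [E0 [E2 _]]. rewrite E0 in H.
    specialize (H i j Hi Hj). rewrite !E2 in H by assumption. specialize (H Hc r).
    assert (A : d (term_value y s i r) (term_value y' s' i r) < eta / 2).
    { apply (Hn1 mu y' mu' s'). eapply near_le; [|exact Hnear]. lia. }
    assert (B : d (term_value y s j r) (term_value y' s' j r) < eta / 2).
    { apply (Hn2 mu y' mu' s'). eapply near_le; [|exact Hnear]. lia. }
    rewrite H in A. rewrite sym in B.
    pose proof (tri (term_value y s i r) (term_value y' s' j r) (term_value y s j r)).
    unfold eta in *. lra.
Qed.

Lemma suslin_endpoints_homologous (K : Type) :
  (exists e : nat -> K, inj e) -> separable d K ->
  suslin K seq_dist endpoints_homologous.
Proof.
  intros [e He] [D [Hdense [f Hf]]].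
  destruct (left_inverse 0%nat e He) as [un Hun].
  destruct (choice_on (L (fun _ => true) 0) (fun k => exists x, f x = k)
    (fun k y => exists x, f x = k /\ proj1_sig x = y)) as [pt Hpt].
  { intros k [x Hx]. exists (proj1_sig x), x. auto. }
  assert (Honto : forall x, D x -> exists k, pt k = x).
  { intros x Dx. exists (f (exist _ x Dx)).
    destruct (Hpt (f (exist _ x Dx))) as [x' [E1 E2]]; [eauto|].
    apply Hf in E1. rewrite <- E2, E1. reflexivity. }
  destruct (suslin_projection d Hmet Hcomp seq_dist D Hdense e un Hun pt Honto
    boundary_code boundary_code_closed) as [C [HC HE]].
  exists C. split; [exact HC|]. intros y. rewrite homologous_code. apply HE.
Qed.

End SuslinHomology.

(** * The dichotomy *)

(* If the relation were nonmeager it would be comeager in some box, and changing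
   one coordinate there would give equivalent points differing in one place. *)
Lemma continuum_inequivalent (Eq : (nat -> bool) -> (nat -> bool) -> Prop) :
  (forall b b', Eq b b' -> Eq b' b) ->
  (forall a b c, Eq a b -> Eq b c -> Eq a c) ->
  (forall b b' n, (forall m, m <> n -> b m = b' m) -> b n <> b' n -> ~ Eq b b') ->
  has_baire_property (@seq_dist (bool * bool))
    (fun y => Eq (fun n => fst (y n)) (fun n => snd (y n))) ->
  exists G : (nat -> bool) -> (nat -> bool), forall b b', Eq (G b) (G b') -> b = b'.
Proof.
  intros Esym Etrans Eflip [O [Oopen Om]].
  destruct (meager_blocks ((true, true) :: (true, false) :: (false, true) :: (false, false) :: nil)
    (true, true) _ ltac:(intros [[|] [|]]; simpl; tauto) Om) as [x [n [n0 [inc HM]]]].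
  destruct (block_index n n0 inc) as [blk Hblk].
  assert (Oempty : forall y, ~ O y).
  { intros y0 Oy. destruct (Oopen y0 Oy) as [eps [Heps He]].
    destruct (half_pow_small eps Heps) as [m Hm].
    (* Such a [y] copies [x] on all late blocks and so avoids the meager set; lying in [O], it must
       lie in the relation. *)
    assert (generic : forall y, agree m y0 y -> (forall i, (m < i)%nat -> y i = x i) ->
      Eq (fun i => fst (y i)) (fun i => snd (y i))).
    { intros y Hy Hx. apply NNPP. intros nE.
      destruct (HM y) as [k0 Hk0].
      - split; [right|tauto]. apply He. eapply Rle_lt_trans; [|exact Hm].
        apply agree_seq_dist, Hy.
      - destruct (Hk0 (k0 + S m)%nat ltac:(lia)) as [i [Hi ne]]. apply ne, Hx.
        assert (ge : forall k, (k <= n k)%nat).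
        { induction k as [|k IH]; [lia|]. specialize (inc k). lia. }
        specialize (ge (k0 + S m)%nat). lia. }
    (* Place [m] is the one coordinate that [generic] leaves free. Both choices of [c] share the
       first component, through which transitivity links the second ones. *)
    set (v := fun (c : bool) i => if Nat.ltb i m then y0 i
              else if Nat.eqb i m then (fst (x i), c) else x i).
    assert (Hv : forall c, Eq (fun i => fst (v c i)) (fun i => snd (v c i))).
    { intros c. apply generic; unfold v; intros i Hi.
      - destruct (Nat.ltb_spec i m); [reflexivity|lia].
      - destruct (Nat.ltb_spec i m); [lia|]. destruct (Nat.eqb_spec i m); [lia|reflexivity]. }
    assert (same : (fun i => fst (v true i)) = (fun i => fst (v false i))).
    { apply functional_extensionality. intros i. unfold v.
      destruct (Nat.ltb i m); [reflexivity|]. destruct (Nat.eqb i m); reflexivity. }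
    apply (Eflip (fun i => snd (v true i)) (fun i => snd (v false i)) m).
    - intros i Hi. unfold v. destruct (Nat.ltb i m); [reflexivity|].
      destruct (Nat.eqb_spec i m); [tauto|reflexivity].
    - unfold v. rewrite Nat.ltb_irrefl, Nat.eqb_refl. discriminate.
    - apply (Etrans _ (fun i => fst (v true i))); [apply Esym, Hv|]. rewrite same. apply Hv. }
  (* By the pairing, each [j] owns infinitely many blocks, on which [G b] copies one component of
     [x] according to [b j]. If [b j] is true and [b' j] false, the pair of [G b] and [G b'] is [x]
     itself on these blocks and so escapes the meager set. *)
  set (G := fun (b : nat -> bool) i =>
    if b (fst (of_nat (blk i))) then fst (x i) else snd (x i)).
  assert (HG : forall b b' j, b j = true -> b' j = false -> ~ Eq (G b) (G b')).
  { intros b b' j Hb Hb' E. destruct (HM (fun i => (G b i, G b' i))) as [k0 Hk0].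
    - split; [left; exact E|]. intros [_ H]. exact (Oempty _ H).
    - pose proof (to_nat_non_decreasing j k0).
      destruct (Hk0 (to_nat (j, k0)) ltac:(lia)) as [i [Hi ne]]. apply ne.
      apply Hblk in Hi. unfold G. rewrite Hi, cancel_of_to. simpl fst at 1 4.
      simpl. rewrite Hb, Hb'. symmetry. apply surjective_pairing. }
  exists G. intros b b' E. apply functional_extensionality. intros j.
  destruct (b j) eqn:Hb, (b' j) eqn:Hb'; try reflexivity; exfalso.
  - exact (HG b b' j Hb Hb' E).
  - exact (HG b' b j Hb' Hb (Esym _ _ E)).
Qed.

(** * Counting homology classes by the continuum *)

Section Continuum.
Context {X : Type} (d : X -> X -> R) (Hmet : is_metric d).

(** Cantor-Bernstein on representatives chosen by [epsilon]. Homologous cycles get the same one,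
    because the predicates handed to [epsilon] are then equal by extensionality. *)
Lemma H1_card_continuum_intro (f : (nat -> bool) -> @chain1 X) (g : @chain1 X -> (nat -> bool)) :
  (forall b, cycle1 d (f b)) -> (forall b b', homologous d (f b) (f b') -> b = b') ->
  (forall c c', cycle1 d c -> cycle1 d c' -> g c = g c' -> homologous d c c') ->
  H1_card_continuum d.
Proof.
  intros Hf finj Hg.
  set (rep := fun c : chain1 => epsilon (inhabits nil) (fun c' => cycle1 d c' /\ homologous d c c')).
  assert (Hrep : forall c, cycle1 d c -> cycle1 d (rep c) /\ homologous d c (rep c)).
  { intros c Hc. unfold rep. apply epsilon_spec. exists c.
    split; [exact Hc|apply homologous_refl]. }
  assert (rep_eq : forall c c', homologous d c c' -> rep c = rep c').
  { intros c c' H. unfold rep. f_equal. apply functional_extensionality. intros c''.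
    apply propositional_extensionality. split; intros [H1 H2]; (split; [exact H1|]).
    - exact (homologous_trans d _ _ _ (homologous_sym d _ _ H) H2).
    - exact (homologous_trans d _ _ _ H H2). }
  assert (rep_hom : forall c c', cycle1 d c -> cycle1 d c' -> rep c = rep c' ->
             homologous d c c').
  { intros c c' Hc Hc' E. apply (homologous_trans d _ (rep c)); [apply Hrep, Hc|].
    rewrite E. apply homologous_sym, Hrep, Hc'. }
  destruct (cantor_bernstein (fun c => cycle1 d c /\ rep c = c) (fun b => rep (f b)) g)
    as [h [Qh [hinj hsur]]].
  - intros b. destruct (Hrep (f b) (Hf b)) as [H1 H2]. split; [exact H1|].
    symmetry. apply rep_eq, H2.
  - intros b b' E. apply finj, rep_hom; auto.
  - intros c c' [Hc Ec] [Hc' Ec'] E. rewrite <- Ec, <- Ec'. apply rep_eq, Hg; assumption.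
  - exists h. split; [intros b; apply Qh|split].
    + intros b b' E. apply hinj. apply rep_eq in E.
      rewrite <- (proj2 (Qh b)), E. apply Qh.
    + intros c Hc. destruct (Hrep c Hc) as [H1 H2]. destruct (hsur (rep c)) as [b Hb].
      * split; [exact H1|]. symmetry. apply rep_eq, H2.
      * exists b. rewrite Hb. exact H2.
Qed.

(** A point is determined by a sequence over [K] that names approximations to it. *)
Lemma points_embed_cantor (K : Type) (D : X -> Prop) (pt : K -> X) :
  dense d D -> (forall x, D x -> exists k, pt k = x) -> emb K (nat -> bool) ->
  emb X (nat -> bool).
Proof.
  intros Hdense Hpt HK. apply (emb_trans (B := nat -> K)); [|apply emb_seq_cantor, HK].
  destruct (choice (fun x (a : nat -> K) => forall j, d x (pt (a j)) < (1/2) ^ j)) as [f Hf].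
  - intros x. apply (choice (fun j k => d x (pt k) < (1/2) ^ j)). intros j.
    destruct (Hdense x ((1/2) ^ j) (half_pow_pos j)) as [y [Dy Hy]].
    destruct (Hpt y Dy) as [k <-]. eauto.
  - exists f. intros x y E. destruct Hmet as [pos [zero [sym tri]]]. apply zero.
    apply Rle_antisym; [|apply pos]. apply Rle_of_small. intros eps Heps.
    destruct (half_pow_small (eps / 2)) as [j Hj]; [lra|].
    pose proof (Hf x j) as A. pose proof (Hf y j) as B. rewrite <- E, sym in B.
    specialize (tri x (pt (f x j)) y). lra.
Qed.

(** A continuous path is determined on [0,1] by its values at the ticks, so a finite list of
    integers and sequences in [X] fixes the coefficients of a chain. *)
Lemma chains_embed_cantor : emb X (nat -> bool) ->
  exists g : @chain1 X -> (nat -> bool), forall c c', cycle1 d c -> cycle1 d c' ->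
    g c = g c' -> homologous d c c'.
Proof.
  intros HX.
  assert (nat_emb : emb nat (nat -> bool)).
  { exists Nat.eqb. intros m n E. apply (f_equal (fun h => h n)) in E.
    rewrite Nat.eqb_refl in E. apply Nat.eqb_eq, E. }
  pose proof (square_embeds _ nat_emb) as sq.
  assert (H : emb (list (Z * (nat -> X))) (nat -> bool)).
  { apply (emb_trans (B := list (nat -> bool))); [|apply emb_list_self; assumption].
    apply emb_list. apply (emb_trans (B := ((nat -> bool) * (nat -> bool))%type)); [|exact sq].
    apply emb_prod; [exact (emb_trans emb_Z_nat nat_emb)|apply emb_seq_cantor, HX]. }
  destruct H as [g Hg].
  exists (fun c => g (map (fun q => (fst q, fun r => snd q (tick r))) c)).
  intros c c' [Hc _] [Hc' _] E. apply Hg in E.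
  apply (bounding_ext d (fun _ => 0%Z)); [|apply bounding_0]. intros s.
  enough (coeff1 c s = coeff1 c' s) by lia.
  revert c' Hc' E. induction Hc as [|[z p] c Hp _ IH]; intros [|[z' p'] c'] Hc' E;
    try discriminate; [reflexivity|].
  inversion Hc' as [|? ? Hp' Hc'']; subst. simpl in E. injection E as E1 E2 E3. subst z'.
  rewrite !coeff1_cons, (IH c' Hc'' E3), (ind_ext p p'); [reflexivity|].
  apply (same1_of_ticks d Hmet); [exact Hp|exact Hp'|].
  intros r. exact (f_equal (fun h => h r) E2).
Qed.

Lemma loop_cycle (g : R -> X) : cont1 d g -> g 0 = g 1 -> cycle1 d ((1%Z, g) :: nil).
Proof.
  intros Hg E. split; [constructor; [exact Hg|constructor]|].
  intros x. unfold bd1coeff. simpl. rewrite E. destruct cdec; reflexivity.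
Qed.

End Continuum.

Theorem theorem4p2 (K : Type)
  (Kinf : exists f : nat -> K, inj f)
  (Klt : (exists g : K -> (nat -> bool), inj g) /\ ~ (exists h : (nat -> bool) -> K, inj h))
  (HBP : BP K)
  (X : Type) (d : X -> X -> R) (Hmet : is_metric d) (Hcomp : complete d)
  (Hsep : separable d K) (Hconn : connected d) (Hlpc : loc_path_connected d) :
  H1_card_le d K \/ H1_card_continuum d.
Proof.
  destruct Hsep as [D [Hdense [f Hf]]].
  destruct (classic (locally_null d D)) as [Hnull|Hnn].
  - left. destruct Kinf as [e He].
    destruct (choice_on (e 0%nat) D (fun x k => exists h : D x, f (exist _ x h) = k))
      as [kappa Hkappa]; [intros x Dx; exists (f (exist _ x Dx)), Dx; reflexivity|].
    apply (locally_null_H1_card_le d Hmet D Hdense Hlpc Hnull kappa); [|exists e; exact He].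
    intros x y Dx Dy E. destruct (Hkappa x Dx) as [h Hh]. destruct (Hkappa y Dy) as [h' Hh'].
    rewrite <- Hh, <- Hh' in E. apply Hf in E. injection E. auto.
  - right. destruct (essential_loops d Hmet D Hdense Hlpc Hnn) as [x0 [l Hl]].
    assert (Hl' : forall n, cont1 d (l n) /\ l n 0 = x0 /\ l n 1 = x0 /\
      (forall t, in_D1 t -> d x0 (l n t) < (1/2) ^ n)) by (intros n; specialize (Hl n); tauto).
    set (L := wedge x0 l).
    pose proof (cont1_wedge d Hmet x0 l Hl') as Lc. fold L in Lc.
    pose proof (suslin_endpoints_homologous d Hmet Hcomp L Lc (wedge_local d x0 l Hl') K Kinf)
      as Hsus.
    assert (Hsep : separable d K) by (exists D; eauto). specialize (Hsus Hsep).
    pose proof (HBP _ seq_dist seq_dist_metric seq_dist_complete seq_bool2_separable _ Hsus)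
      as Hbp.
    assert (flip1 : forall b b' n, (forall m, m <> n -> b m = b' m) -> b n = true ->
      b' n = false -> ~ homologous d ((1%Z, L b) :: nil) ((1%Z, L b') :: nil)).
    { intros b b' n Hbb Hb Hb' H. apply (proj2 (proj2 (proj2 (proj2 (Hl n))))).
      pose proof (wedge_flip d Hmet x0 l Hl' b b' n Hbb Hb Hb') as W.
      eapply bounding_ext; [|exact (bounding_sub d _ _ H W)].
      intros s. cbv beta. rewrite !coeff1_cons. unfold L, coeff1; simpl fold_right. ring. }
    destruct (continuum_inequivalent
      (fun b b' => homologous d ((1%Z, L b) :: nil) ((1%Z, L b') :: nil))) as [G HG].
    + intros b b'. apply homologous_sym.
    + intros a b c. apply homologous_trans.
    + intros b b' n Hbb ne. destruct (b n) eqn:Hb, (b' n) eqn:Hb'; try tauto.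
      * apply (flip1 b b' n Hbb Hb Hb').
      * intros H. apply (flip1 b' b n); auto.
        -- intros m Hm. symmetry. auto.
        -- apply homologous_sym, H.
    + exact Hbp.
    + destruct Kinf as [e He].
      destruct (choice_on x0 (fun k => exists x, f x = k)
        (fun k y => exists x, f x = k /\ proj1_sig x = y)) as [pt Hpt].
      { intros k [x Hx]. eauto. }
      destruct (chains_embed_cantor d Hmet) as [g Hg].
      (* Here the embedding of [K] into the Cantor space enters: it bounds the number of points of
         [X], hence of cycles up to homology. *)
      { apply (points_embed_cantor d Hmet K D pt Hdense); [|exact (proj1 Klt)].
        intros x Dx. exists (f (exist _ x Dx)).
        destruct (Hpt (f (exist _ x Dx))) as [x' [E1 E2]]; [eauto|].
        apply Hf in E1. rewrite <- E2, E1. reflexivity. }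
      apply (H1_card_continuum_intro d (fun b => (1%Z, L (G b)) :: nil) g); [|exact HG|exact Hg].
      intros b. apply loop_cycle; [apply Lc|].
      destruct (wedge_ends d x0 l Hl' (G b)) as [E0 E1]. unfold L. congruence.
Qed.
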